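(* Let $n\ge2$, $p\in[1,n)$ and let $K\subset\mathbb{R}^n$ be a compact set. For any $\tau\in[-1,1]$, $$C_{p,\tau}(K)\le A(n,p)\cdot C_p(K),$$ where $$A(n,p)=\frac{(n-1)\,\omega_{n-1}}{2n\,\omega_n}\,B\Big(\frac{p+1}{2},\frac{n-1}{2}\Big).$$
   Context: $\omega_k=\pi^{k/2}/\Gamma(1+k/2)$ is the volume of the unit ball in $\mathbb{R}^k$ and $B(x,y)=\int_0^1t^{x-1}(1-t)^{y-1}\,dt$ is the Beta function. $du$ is the rotation-invariant probability measure on $S^{n-1}$. For $\tau\in[-1,1]$ let $\varphi_\tau(t)=\big(\tfrac{1+\tau}{2}\big)^{1/p}t_++\big(\tfrac{1-\tau}{2}\big)^{1/p}t_-$, with $t_+=\max\{t,0\}$, $t_-=\max\{-t,0\}$. For $f\in C_c^\infty(\mathbb{R}^n)$ let $$\mathcal{H}_{p,\tau}(f)=\Big(\int_{S^{n-1}}\Big(\int_{\mathbb{R}^n}[\varphi_\tau(u\cdot\nabla f(x))]^p\,dx\Big)^{-n/p}du\Big)^{-p/n}$$ (with conventions $1/0=\infty$, $1/\infty=0$, so that $\mathcal{H}_{p,\tau}(0)=0$). For a compact set $K\subset\mathbb{R}^n$, the general $p$-affine capacity is $$C_{p,\tau}(K)=\inf\{\mathcal{H}_{p,\tau}(f):\ f\in C_c^\infty(\mathbb{R}^n),\ f\ge1\text{ on }K\},$$ and the $p$-variational capacity is $$C_p(K)=\inf\Big\{\int_{\mathbb{R}^n}|\nabla f|^p\,dx:\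 f\in C_c^\infty(\mathbb{R}^n),\ f\ge1\text{ on }K\Big\}.$$ *)

(* Defs.v *)
From HB Require Import structures.
From mathcomp Require Import all_boot all_order all_algebra.
From mathcomp Require Import all_classical all_reals all_analysis.
Set Implicit Arguments.
Unset Strict Implicit.
Unset Printing Implicit Defensive.
Import Order.TTheory GRing.Theory Num.Theory.
Import numFieldNormedType.Exports.
Local Open Scope classical_set_scope.
Local Open Scope ring_scope.

(* Row vectors 'rV[R]_n stand for R^n.  The library's norm on them is the sup
   norm: it gives the right topology, but the Euclidean norm is [enorm]. *)
Notation borel_rV R n := (g_sigma_algebraType (@open 'rV[R]_n)).

Section lebesgue_measure_rV.
Context {R : realType}.

Definition cons_rV n (z : measurableTypeR R * borel_rV R n) :
    borel_rV R n.+1 :=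
  row_mx (z.1%:M : 'rV[R]_1) (z.2 : 'rV[R]_n).

(* The n-fold product of the one-dimensional Lebesgue measure, carried over
   from R * (R * ...) to row vectors. *)
Fixpoint lebesgue_rV (n : nat) : set (borel_rV R n) -> \bar R :=
  match n with
  | 0 => \d_((0 : 'rV[R]_0) : borel_rV R 0)
  | m.+1 => pushforward (@lebesgue_measure R \x @lebesgue_rV m)%E (@cons_rV m)
  end.

Lemma preimage_cons_ball n (c : 'rV[R]_n.+1) (r : R) :
  @cons_rV n @^-1` (ball c r : set 'rV[R]_n.+1) =
  (ball (c ord0 ord0) r : set R) `*`
  (ball (\row_j c ord0 (lift ord0 j)) r : set 'rV[R]_n).
Proof.
apply/seteqP; split => -[x y] /=.
- move=> [r0 h]; split.
    have := h ord0 ord0; rewrite /cons_rV /= mxE.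
    case: splitP => [j _|j /= /eqP]; last by rewrite add1n.
    by rewrite (ord1 j) mxE eqxx mulr1n.
  split=> // i j; have := h ord0 (lift ord0 j); rewrite (ord1 i) /cons_rV /= !mxE.
  case: splitP => [k /= |k /= /eqP].
    by move=> /eqP; rewrite /bump /= (ord1 k).
  rewrite /bump /= eqSS => /eqP jk.
  by have -> : j = k by apply/val_inj.
- move=> [hx [r0 hy]]; split=> // i j; rewrite (ord1 i) /cons_rV /= mxE.
  case: splitP => [k /= jk|k /= jk].
    by rewrite (ord1 k) mxE eqxx mulr1n; have -> : j = ord0
      by apply/val_inj; rewrite /= jk (ord1 k).
  have := hy ord0 k; rewrite mxE.
  by have -> : lift ord0 k = j by apply/val_inj; rewrite /= jk.
Qed.

Lemma measurable_ball_rV n (c : 'rV[R]_n) (r : R) :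
  measurable (ball c r : set (borel_rV R n)).
Proof. by apply: sub_sigma_algebra; exact: ball_open. Qed.

Lemma open_rV_bigcup_ball n (U : set 'rV[R]_n) : open U ->
  U = \bigcup_(z in [set z : 'rV[rat]_n * rat |
        ball (map_mx ratr z.1 : 'rV[R]_n) (ratr z.2) `<=` U])
      ball (map_mx ratr z.1 : 'rV[R]_n) (ratr z.2).
Proof.
move=> oU; apply/seteqP; split => [x Ux|x [z zU]]; last exact: zU.
have /nbhs_ballP[e /= e0 eU] : nbhs x U by exact: open_nbhs_nbhs.
have [r /andP[r0 re]] : exists r : rat, 0 < (ratr r : R) < e / 2.
  have e2 : 0 < e / 2 by rewrite divr_gt0.
  have [r] := rat_in_itvoo e2.
  by rewrite in_itv /= => rP; exists r.
have q_ j : exists q : rat, `|x ord0 j - ratr q| < ratr r.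
  have /rat_in_itvoo[q] : x ord0 j - ratr r < x ord0 j + ratr r.
    by rewrite ltrBlDr -addrA ltrDl addr_gt0.
  rewrite in_itv /= => /andP[q1 q2]; exists q.
  by rewrite ltr_norml; apply/andP; split;
    [rewrite ltrBrDl ltrBlDr // |rewrite ltrBlDl -ltrBlDr].
have [q qP] := choice q_.
pose c : 'rV[R]_n := map_mx ratr (\row_j q j).
have xc : ball c (ratr r) x.
  by split=> // i j; rewrite (ord1 i) !mxE /ball /= distrC.
exists (\row_j q j, r) => //=.
apply: subset_trans eU => y cy.
apply: (@le_ball _ _ _ (ratr r + ratr r)).
  by rewrite (splitr e) lerD // ltW.
by apply: ball_triangle cy; exact: ball_sym.
Qed.

Lemma measurable_cons_rV n : measurable_fun setT (@cons_rV n).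
Proof.
apply: (@measurability _ _ _ (borel_rV R n.+1) _ _ (@open 'rV[R]_n.+1)) => //.
move=> _ [U oU <-]; rewrite setTI (open_rV_bigcup_ball oU).
rewrite preimage_bigcup bigcup_mkcond.
apply: countable_bigcupT_measurable => // z.
case: ifPn => // _; rewrite preimage_cons_ball; apply: measurableX.
  exact: measurable_realfun.measurable_ball.
exact: measurable_ball_rV.
Qed.

Definition is_sigma_finite_measure n (mu : set (borel_rV R n) -> \bar R) :=
  [/\ mu set0 = 0%E, forall A, (0 <= mu A)%E, semi_sigma_additive mu
    & forall r, (mu (ball (0%R : 'rV[R]_n) r) < +oo)%E].

Lemma sigma_finite_ball n (mu : set (borel_rV R n) -> \bar R) :
  is_sigma_finite_measure mu -> sigma_finite setT mu.
Proof.
move=> [_ _ _ muoo]; exists (fun k => ball (0 : 'rV[R]_n) k%:R).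
  apply/seteqP; split => // x _; exists (Num.truncn `|x|).+1 => //.
  rewrite /= mx_norm_ball /ball_ /= sub0r normrN.
  exact: truncnS_gt.
by move=> k; split; [exact: measurable_ball_rV|exact: muoo].
Qed.

(* Receives the canonical measure structure of the properties H of mu; it serves
   to prove by induction that [lebesgue_rV] is a sigma-finite measure. *)
Definition pack_measure n (mu : set (borel_rV R n) -> \bar R)
  (H : is_sigma_finite_measure mu) : set (borel_rV R n) -> \bar R := mu.

Section product_step.
Variables (n : nat) (mu : set (borel_rV R n) -> \bar R).
Variable H : is_sigma_finite_measure mu.

HB.instance Definition _ := isMeasure.Build _ _ _ (pack_measure H)
  (let: And4 h _ _ _ := H in h) (let: And4 _ h _ _ := H in h)
  (let: And4 _ _ h _ := H in h).

HB.instance Definition _ := Measure_isSigmaFinite.Build _ _ _ (pack_measure H)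
  (sigma_finite_ball H).

Let nu := pushforward (@lebesgue_measure R \x pack_measure H)%E (@cons_rV n).

Lemma is_sigma_finite_measure_cons : is_sigma_finite_measure nu.
Proof.
have mc := @measurable_cons_rV n.
have nu_ge0 : forall A, (0 <= nu A)%E by move=> A; exact: measure_ge0.
split.
- by rewrite /nu /pushforward preimage_set0 measure0.
- exact: nu_ge0.
- exact: measure_semi_sigma_additive.
- move=> r; rewrite /nu /pushforward preimage_cons_ball.
  rewrite product_measure1E; last 2 first.
  + exact: measurable_realfun.measurable_ball.
  + exact: measurable_ball_rV.
  have -> : \row_j (0 : 'rV[R]_n.+1) ord0 (lift ord0 j) = 0 :> 'rV[R]_n.
    by apply/rowP => j; rewrite !mxE.
  have [r0|r0] := leP 0 r; last first.
    by rewrite (ball0 _ _).2 ?measure0 ?mul0e // ltW.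
  have E := lebesgue_measure_ball ((0 : 'rV[R]_n.+1) ord0 ord0) r0.
  apply: lte_mul_pinfty; [by []|by rewrite [X in X \is a _]E|by case: H].
Qed.

End product_step.

Lemma lebesgue_rVP n : is_sigma_finite_measure (@lebesgue_rV n).
Proof.
elim: n => [|n IHn]; last exact: (is_sigma_finite_measure_cons IHn).
split; [exact: measure0|by move=> A; exact: measure_ge0
  |exact: measure_semi_sigma_additive|move=> r].
by rewrite /= diracE ltry.
Qed.

HB.instance Definition _ n := isMeasure.Build _ _ _ (@lebesgue_rV n)
  (let: And4 h _ _ _ := lebesgue_rVP n in h)
  (let: And4 _ h _ _ := lebesgue_rVP n in h)
  (let: And4 _ _ h _ := lebesgue_rVP n in h).

HB.instance Definition _ n := Measure_isSigmaFinite.Build _ _ _ (@lebesgue_rV n)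
  (sigma_finite_ball (lebesgue_rVP n)).

End lebesgue_measure_rV.
Arguments lebesgue_rV : simpl never.

Section special_functions.
Context {R : realType}.
Implicit Types x y : R.

Definition Gamma x : R :=
  \int[@lebesgue_measure R]_(t in `]0, +oo[) (t `^ (x - 1) * expR (- t)).

Definition Beta x y : R :=
  \int[@lebesgue_measure R]_(t in `]0, 1[)
    (t `^ (x - 1) * (1 - t) `^ (y - 1)).

Definition omega (k : nat) : R := pi `^ (k%:R / 2) / Gamma (1 + k%:R / 2).

End special_functions.

Section euclidean.
Context {R : realType} {n : nat}.
Implicit Types (u v x : 'rV[R]_n) (f : 'rV[R]_n -> R).

Definition dotp u v : R := \sum_(i < n) u ord0 i * v ord0 i.

Definition enorm u : R := Num.sqrt (dotp u u).

Definition sphere : set 'rV[R]_n := [set u | enorm u = 1].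

Definition partial (i : 'I_n) f : 'rV[R]_n -> R := 'D_(delta_mx ord0 i) f.

Definition grad f x : 'rV[R]_n := \row_(i < n) partial i f x.

Fixpoint Ck (k : nat) f : Prop :=
  continuous f /\
  if k is m.+1 then
    forall i : 'I_n,
      (forall x, derivable f x (delta_mx ord0 i)) /\ Ck m (partial i f)
  else True.

Definition smooth f : Prop := forall k, Ck k f.

Definition test_function f : Prop :=
  smooth f /\ compact (closure [set x | f x != 0]).

(* Rotations are the elements of SO(n), acting on row vectors on the right.  For
   n >= 2 exactly one probability measure satisfies this predicate. *)
Definition is_sphere_measure (sigma : set (borel_rV R n) -> \bar R) : Prop :=
  sigma sphere = 1%E /\
  forall Q : 'M[R]_n, Q *m Q^T = 1%:M -> \det Q = 1 ->
  forall A : set (borel_rV R n), measurable A ->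
    sigma ((fun u : 'rV[R]_n => u *m Q) @^-1` A) = sigma A.

End euclidean.

Section capacities.
Context {R : realType} {n : nat}.
Implicit Types (sigma : probability (borel_rV R n) R) (p tau t : R).
Implicit Types (f : 'rV[R]_n -> R) (K : set 'rV[R]_n).

Definition phi p tau t : R :=
  ((1 + tau) / 2) `^ p^-1 * Num.max t 0 +
  ((1 - tau) / 2) `^ p^-1 * Num.max (- t) 0.

(* x ^ (- r) for x in [0, +oo] and r > 0, with 1 / 0 = +oo and 1 / +oo = 0.  The
   library's 0 `^ (- r) is 0, whereas its inverse of 0 in \bar R is +oo. *)
Definition eneg_pow (x : \bar R) (r : R) : \bar R := ((x `^ r)^-1)%E.

Definition affine_energy sigma p tau f : \bar R :=
  eneg_pow
    (\int[sigma]_(u in sphere)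
       eneg_pow
         (\int[@lebesgue_rV R n]_x (phi p tau (dotp u (grad f x)) `^ p)%:E)
         (n%:R / p))%E
    (p / n%:R).

Definition dirichlet_energy p f : \bar R :=
  (\int[@lebesgue_rV R n]_x (enorm (grad f x) `^ p)%:E)%E.

Definition admissible K f : Prop :=
  test_function f /\ (forall x, K x -> 1 <= f x).

Definition affine_capacity sigma p tau K : \bar R :=
  ereal_inf [set affine_energy sigma p tau f | f in admissible K].

Definition variational_capacity p K : \bar R :=
  ereal_inf [set dirichlet_energy p f | f in admissible K].

End capacities.

Definition capacity_const {R : realType} (n : nat) (p : R) : R :=
  (n%:R - 1) * omega n.-1 / (2 * n%:R * omega n) *
  Beta ((p + 1) / 2) ((n%:R - 1) / 2).

(* Main.v *)
Require Import Defs.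
From HB Require Import structures.
From mathcomp Require Import all_boot all_order all_algebra.
From mathcomp Require Import all_classical all_reals all_analysis.
From mathcomp Require Import measurable_realfun ring lra.
Import Order.TTheory GRing.Theory Num.Theory.
Import numFieldNormedType.Exports.
Local Open Scope classical_set_scope.
Local Open Scope ring_scope.

(* For I u := \int phi_tau(u . grad f)^p, the power mean (\int I^(- n/p))^(- p/n)
   is at most \int I, because x^(- q) lies above its tangent lines.  By Tonelli
   and the rotation invariance of sigma, \int I dsigma = m \int |grad f|^p, where
   m is the mean over the sphere of (u_1)_+^p; tau disappears since u and - u play
   the same role.  To compute m without polar coordinates, integrate
   (u . x)_+^p |x|^(- p) exp(- |x|^2) over u and x: on one side it is m times the
   mass of a Gaussian; on the other side |x|^(- p) is a mixture of Gaussians,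
   and the marginals of a Gaussian are known.  What is left are identities between
   Gamma and Beta integrals, all obtained from Tonelli and affine changes of
   variable. *)

(** The test integrand works because (u . x)_+^p |x|^(- p) is homogeneous of degree 0 in x:
    averaging over u leaves the constant m times a bare Gaussian. In the other order, |x|^(- p) is 1
    / Gamma(p/2) times the integral over l > 0 of l^(p/2 - 1) exp(- l |x|^2), so for fixed l the
    weight is exp(- (1 + l) |x|^2). Its integral against (u . x)_+^p depends on u only through |u| =
    1 and scales as (1 + l)^(- (n + p)/2). What remains over l is a Beta integral of the second
    kind, whence m = Gamma((p + 1)/2) Gamma(n/2) / (2 sqrt(pi) Gamma((n + p)/2)). This is A(n, p);
    its factor 1/2 is that of a Gaussian moment over a half-line. The integrands are nonnegative and
    the integrals live in [\bar R], so Tonelli asks for no integrability; positivity and finiteness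
    of Gamma are proved separately, to cancel factors. *)

(** * Tonelli and affine changes of variable on the line *)

Lemma tonelli_swap {d1 d2} {T1 : measurableType d1} {T2 : measurableType d2}
    {R : realType} (m1 : {sigma_finite_measure set T1 -> \bar R})
    (m2 : {sigma_finite_measure set T2 -> \bar R}) (f : T1 -> T2 -> \bar R) :
  @measurable_fun _ _ (T1 * T2)%type (\bar R) setT (fun z => f z.1 z.2) ->
  (forall x y, (0 <= f x y)%E) ->
  (\int[m1]_x \int[m2]_y f x y = \int[m2]_y \int[m1]_x f x y)%E.
Proof.
move=> mf f0.
exact: (fubini_tonelli (fun z => f z.1 z.2) mf (fun z => f0 z.1 z.2)).
Qed.

Lemma tonelli_measurable {d1 d2} {T1 : measurableType d1} {T2 : measurableType d2}
    {R : realType} (m2 : {sigma_finite_measure set T2 -> \bar R})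
    (f : T1 -> T2 -> \bar R) :
  @measurable_fun _ _ (T1 * T2)%type (\bar R) setT (fun z => f z.1 z.2) ->
  (forall x y, (0 <= f x y)%E) ->
  @measurable_fun _ _ T1 (\bar R) setT (fun x => \int[m2]_y f x y)%E.
Proof.
move=> mf f0.
exact: (measurable_fun_fubini_tonelli_F (m2 := m2) _ mf (fun z => f0 z.1 z.2)).
Qed.

Section one_dimensional.
Context {R : realType}.
Local Notation mu := (@lebesgue_measure R).
Implicit Types (g : R -> \bar R) (a b c s t x y : R).

(** Lebesgue measure equals |a| times its pushforward under t |-> a t + b, by uniqueness: the two
    agree on half-open intervals. *)
Lemma ge0_integral_affine a b g : a != 0 -> measurable_fun setT g ->
  (forall t, (0 <= g t)%E) ->
  (\int[mu]_t g (a * t + b)%R = `|a|^-1%:E * \int[mu]_t g t)%E.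
Proof.
move=> a0 mg g0.
have na0 : 0 < `|a| by rewrite normr_gt0.
pose phi : measurableTypeR R -> measurableTypeR R := fun t : R => a * t + b.
have mphi : measurable_fun setT phi.
  by apply: measurable_realfun.measurable_funD => //;
    exact: measurable_realfun.mulrl_measurable.
pose pf : {measure set (measurableTypeR R) -> \bar R} :=
  measure_function_pushforward__canonical__measure_function_Measure mu mphi.
pose nu := mscale (NngNum (ltW na0)) pf.
have nuE A : measurable A -> mu A = nu A.
  apply: lebesgue_measure_unique => _ [[x y] _ <-].
  (* A negative a reverses the interval, so the closed end moves to the left. *)
  pose I := if 0 < a then `](x - b) / a, (y - b) / a]%classic
      else `[(y - b) / a, (x - b) / a[%classic.
  have phiE : phi @^-1` `]x, y]%classic = I.
    rewrite /I; apply/seteqP; split=> t; case: ltP => a_gt0;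
      rewrite /phi /= !in_itv /=.
    + by rewrite ltr_pdivrMr // ler_pdivlMr // ltrBlDr lerBrDr [t * a]mulrC.
    + have {}a_gt0 : a < 0 by rewrite lt_neqAle a0.
      by rewrite ltr_ndivlMr // ler_ndivrMr // ltrBlDr lerBrDr [t * a]mulrC andbC.
    + by rewrite ltr_pdivrMr // ler_pdivlMr // ltrBlDr lerBrDr [t * a]mulrC.
    + have {}a_gt0 : a < 0 by rewrite lt_neqAle a0.
      by rewrite ltr_ndivlMr // ler_ndivrMr // ltrBlDr lerBrDr [t * a]mulrC andbC.
  transitivity (`|a|%:E * mu I)%E; last by rewrite -phiE.
  rewrite /I.
  rewrite lebesgue_measure_itv /= lte_fin; case: (ltP 0 a) => [a_gt0|a_le0].
    rewrite lebesgue_measure_itv /= lte_fin ltr_pM2r ?invr_gt0 // ltrD2r.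
    rewrite gtr0_norm //; case: ifP => _; last by rewrite mule0.
    by rewrite -!EFinD -EFinM; congr EFin; field.
  have a_lt0 : a < 0 by rewrite lt_neqAle a0.
  rewrite lebesgue_measure_itv /= lte_fin ltr_nM2r ?invr_lt0 // ltrD2r.
  rewrite ltr0_norm //; case: ifP => _; last by rewrite mule0.
  by rewrite -!EFinD -EFinM; congr EFin; field.
have -> : (\int[mu]_t g t = `|a|%:E * \int[mu]_t g (phi t))%E.
  transitivity (\int[nu]_t g t)%E.
    by apply: eq_measure_integral => A mA _; exact: nuE.
  rewrite ge0_integral_mscale //; congr (_ * _)%E.
  rewrite /pf ge0_integral_pushforward //.
by rewrite muleA -EFinM mulVf ?gt_eqF // mul1e.
Qed.

Lemma ge0_integral_scale c g : 0 < c -> measurable_fun setT g ->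
  (forall t, (0 <= g t)%E) ->
  (\int[mu]_t g t = c%:E * \int[mu]_t g (c * t)%R)%E.
Proof.
move=> c0 mg g0; under [in RHS]eq_integral do rewrite -[(c * _)%R]addr0.
rewrite ge0_integral_affine ?gt_eqF // muleA -EFinM gtr0_norm // divff ?gt_eqF //.
by rewrite mul1e.
Qed.

Lemma ge0_integral_translate b g : measurable_fun setT g ->
  (forall t, (0 <= g t)%E) ->
  (\int[mu]_t g (t + b)%R = \int[mu]_t g t)%E.
Proof.
move=> mg g0; under [in LHS]eq_integral do rewrite -[X in (X + b)%R]mul1r.
by rewrite ge0_integral_affine ?oner_eq0 // normr1 invr1 mul1e.
Qed.

End one_dimensional.

(** * Gamma and Beta integrals *)

Section truncated_power.
Context {R : realType}.
Implicit Types (a b c r s t x y : R).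

Lemma gt0_powRD x r s : 0 < x -> x `^ (r + s) = x `^ r * x `^ s.
Proof. by move=> x0; rewrite powRD // (gt_eqF x0) implybT. Qed.

(* Truncation makes every integral below run over the whole line, so that Tonelli
   and affine changes of variable apply without tracking domains. *)
Definition tpow s t : R := if 0 < t then t `^ s else 0.

Lemma tpow_ge0 s t : 0 <= tpow s t.
Proof. by rewrite /tpow; case: ifP => // _; exact: powR_ge0. Qed.

Lemma gt0_tpow s t : 0 < t -> tpow s t = t `^ s.
Proof. by rewrite /tpow => ->. Qed.

Lemma le0_tpow s t : t <= 0 -> tpow s t = 0.
Proof. by rewrite /tpow leNgt => /negbTE ->. Qed.

Lemma measurable_tpow s : measurable_fun setT (tpow s).
Proof.
apply: measurable_fun_ifT; last exact: measurable_cst.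
- exact: measurable_fun_ltr.
- exact: measurable_powR.
Qed.

Lemma tpowZ s c t : 0 < c -> tpow s (c * t) = c `^ s * tpow s t.
Proof.
move=> c0; rewrite /tpow pmulr_rgt0 //; case: ifP => t0; last by rewrite mulr0.
by rewrite powRM // ltW.
Qed.

End truncated_power.

(** * Measurability of functions of row vectors *)

Section coordinates.
Context {R : realType}.

Lemma measurable_continuous_rV n (g : 'rV[R]_n -> R) : continuous g ->
  measurable_fun setT (g : borel_rV R n -> R).
Proof.
move=> cg; apply: (measurability _ (RGenOInfty.measurableE R)).
move=> _ [_ [x ->] <-]; rewrite setTI; apply: sub_sigma_algebra.
by move/continuousP : cg; apply; exact: interval_open.
Qed.

Lemma measurable_coord n (i : 'I_n) :
  measurable_fun setT (fun x : borel_rV R n => (x : 'rV[R]_n) ord0 i).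
Proof. by apply: measurable_continuous_rV; exact: coord_continuous. Qed.

Lemma measurable_dotp d (T : measurableType d) n (f g : T -> borel_rV R n) :
  measurable_fun setT f -> measurable_fun setT g ->
  measurable_fun setT (fun z => dotp (f z) (g z)).
Proof.
move=> mf mg; apply: measurable_sum => i.
apply: measurable_realfun.measurable_funM.
  exact: (measurableT_comp (measurable_coord _ i) mf).
exact: (measurableT_comp (measurable_coord _ i) mg).
Qed.

End coordinates.

(** Structural recursion on the integrand. The patterns [@?f z] recover the inner function as an
    explicit argument; the last branch handles functions whose measurability is a hypothesis. *)
Ltac measurability_step :=
  first [exact: measurable_cst | lazymatch goal with
  | |- measurable_fun _ (fun z => z) => exact: measurable_id
  | |- measurable_fun _ (fun z => fst z) => exact: measurable_fst
  | |- measurable_fun _ (fun z => snd z) => exact: measurable_snd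
  | |- measurable_fun _ (fun z => fst (@?f z)) =>
      apply: (measurableT_comp measurable_fst (g := f))
  | |- measurable_fun _ (fun z => snd (@?f z)) =>
      apply: (measurableT_comp measurable_snd (g := f))
  | |- measurable_fun _ (fun z => EFin _) => apply/measurable_EFinP
  | |- measurable_fun _ (fun z => mule (@?f z) (@?g z)) =>
      apply: (emeasurable_funM (f := f) (g := g))
  | |- measurable_fun _ (fun z => GRing.mul (@?f z) (@?g z)) =>
      apply: (measurable_realfun.measurable_funM (f := f) (g := g))
  | |- measurable_fun _ (fun z => GRing.add (@?f z) (@?g z)) =>
      apply: (measurable_realfun.measurable_funD (f := f) (g := g))
  | |- measurable_fun _ (fun z => GRing.opp (@?f z)) =>
      apply: (measurable_realfun.measurable_funN (f := f))
  | |- measurable_fun _ (fun z => GRing.exp (@?f z) ?n) =>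
      apply: (measurable_funX (f := f) n)
  | |- measurable_fun _ (fun z => expR (@?f z)) =>
      apply: (measurableT_comp (@measurable_expR _) (g := f))
  | |- measurable_fun _ (fun z => tpow ?s (@?f z)) =>
      apply: (measurableT_comp (measurable_tpow s) (g := f))
  | |- measurable_fun _ (fun z => dotp (@?f z) (@?g z)) =>
      apply: (measurable_dotp _ _ _ f g)
  | |- measurable_fun _ (fun z => powR (@?f z) ?s) =>
      apply: (measurableT_comp (@measurable_powR _ s) (g := f))
  | |- measurable_fun _ (fun z => ?h (@?f z)) =>
      match goal with H : measurable_fun _ h |- _ =>
        apply: (measurableT_comp H (g := f)) end
  end].
Ltac measurability_tac := cbn beta; repeat (measurability_step; cbn beta).

Section gamma.
Context {R : realType}.
Local Notation mu := (@lebesgue_measure R).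
Implicit Types (a b c r s t x y : R).

(** Extended-real values let the identities hold for all parameters, convergent or not; [eGammaE]
    makes the link with [Gamma] once finiteness is known. *)
Definition eGamma a : \bar R := \int[mu]_t (tpow (a - 1) t * expR (- t))%:E.

Definition eBeta a b : \bar R :=
  \int[mu]_t (tpow (a - 1) t * tpow (b - 1) (1 - t))%:E.

Lemma eGamma_ge0 a : (0 <= eGamma a)%E.
Proof.
by apply: integral_ge0 => t _; rewrite lee_fin mulr_ge0 ?tpow_ge0 ?expR_ge0.
Qed.

(** With s = |x|^2 and a = p/2 this is the mixture of Gaussians that represents |x|^(- p). *)
Lemma eGamma_scale s a : 0 < s ->
  (\int[mu]_t (tpow (a - 1) t * expR (- (s * t)))%:E =
   (s `^ (- a))%:E * eGamma a)%E.
Proof.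
move=> s0.
rewrite /eGamma [in RHS](@ge0_integral_scale _ s) //; last 2 first.
- measurability_tac.
- by move=> t; rewrite lee_fin mulr_ge0 ?tpow_ge0 ?expR_ge0.
rewrite muleA -ge0_integralZl //; last 3 first.
- measurability_tac.
- by move=> t _; rewrite lee_fin mulr_ge0 ?tpow_ge0 ?expR_ge0.
- by rewrite -EFinM lee_fin mulr_ge0 ?powR_ge0 // ltW.
apply: eq_integral => t _; rewrite tpowZ // -!EFinM; congr EFin.
rewrite mulrA; congr (_ * _); rewrite mulrA -[LHS]mul1r; congr (_ * _).
rewrite -[X in _ * X * _]powRr1 ?(ltW s0) // -!gt0_powRD //.
by rewrite (_ : - a + 1 + (a - 1) = 0) ?powRr0 //; ring.
Qed.

(** The Beta integral of the second kind. [eGamma_scale] writes s^(- b) Gamma(b) as an integral over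
    t for each s; integrating over s first then meets exp(- (1 + t) s), and [eGamma_scale] applies
    again. *)
Lemma eGammaM_Beta2 a b :
  (eGamma a * eGamma b = eGamma (a + b) *
     \int[mu]_t (tpow (b - 1) t * (1 + t) `^ (- (a + b)))%:E)%E.
Proof.
transitivity (\int[mu]_s \int[mu]_t
    (tpow (a + b - 1) s * expR (- s) * (tpow (b - 1) t * expR (- (s * t))))%:E)%E.
  rewrite -ge0_integralZr //; last 3 first.
  - measurability_tac.
  - by move=> t _; rewrite lee_fin mulr_ge0 ?tpow_ge0 ?expR_ge0.
  - exact: eGamma_ge0.
  apply: eq_integral => s _.
  have [s0|s0] := leP s 0.
    rewrite le0_tpow // mul0r mul0e; apply/esym.
    by apply: integral0_eq => t _; rewrite le0_tpow // !mul0r.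
  under [RHS]eq_integral do rewrite EFinM.
  rewrite ge0_integralZl //; last 3 first.
  - measurability_tac.
  - by move=> t _; rewrite lee_fin mulr_ge0 ?tpow_ge0 ?expR_ge0.
  - by rewrite lee_fin mulr_ge0 ?tpow_ge0 ?expR_ge0.
  rewrite eGamma_scale // muleA -!EFinM; congr (EFin _ * _)%E.
  rewrite mulrAC; congr (_ * _); rewrite !gt0_tpow // -gt0_powRD //.
  by congr (_ `^ _); ring.
rewrite tonelli_swap; last 2 first.
- measurability_tac.
- by move=> s t; rewrite lee_fin !mulr_ge0 ?tpow_ge0 ?expR_ge0.
rewrite -ge0_integralZl //; last 3 first.
- measurability_tac.
- by move=> t _; rewrite lee_fin mulr_ge0 ?tpow_ge0 ?powR_ge0.
- exact: eGamma_ge0.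
apply: eq_integral => t _.
have [t0|t0] := leP t 0.
  rewrite (le0_tpow _ t) // mul0r mule0.
  by apply: integral0_eq => s _; rewrite mul0r mulr0.
transitivity (\int[mu]_s ((tpow (b - 1) t)%:E *
    (tpow (a + b - 1) s * expR (- ((1 + t) * s)))%:E))%E.
  apply: eq_integral => s _; rewrite -EFinM; congr EFin.
  by rewrite mulrDl mul1r opprD expRD [s * t]mulrC; ring.
rewrite ge0_integralZl //; last 3 first.
- measurability_tac.
- by move=> s _; rewrite lee_fin mulr_ge0 ?tpow_ge0 ?expR_ge0.
- by rewrite lee_fin tpow_ge0.
by rewrite eGamma_scale ?addr_gt0 // muleA -EFinM muleC.
Qed.

(* t is replaced by w - s, then s by w * q. *)
Lemma eGammaM_Beta a b :
  (eGamma a * eGamma b = eGamma (a + b) * eBeta a b)%E.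
Proof.
transitivity (\int[mu]_s \int[mu]_w
    (tpow (a - 1) s * tpow (b - 1) (w - s) * expR (- w))%:E)%E.
  rewrite -ge0_integralZr //; last 3 first.
  - measurability_tac.
  - by move=> t _; rewrite lee_fin mulr_ge0 ?tpow_ge0 ?expR_ge0.
  - exact: eGamma_ge0.
  apply: eq_integral => s _.
  rewrite [eGamma b]/eGamma -(@ge0_integral_translate _ (- s)); last 2 first.
  - measurability_tac.
  - by move=> t; rewrite lee_fin mulr_ge0 ?tpow_ge0 ?expR_ge0.
  rewrite -ge0_integralZl //; last 3 first.
  - measurability_tac.
  - by move=> t _; rewrite lee_fin mulr_ge0 ?tpow_ge0 ?expR_ge0.
  - by rewrite lee_fin mulr_ge0 ?tpow_ge0 ?expR_ge0.
  apply: eq_integral => w _; rewrite -EFinM; congr EFin.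
  by rewrite mulrACA -expRD; congr (_ * expR _); ring.
rewrite tonelli_swap; last 2 first.
- measurability_tac.
- by move=> s t; rewrite lee_fin !mulr_ge0 ?tpow_ge0 ?expR_ge0.
rewrite -ge0_integralZr //; last 3 first.
- measurability_tac.
- by move=> t _; rewrite lee_fin mulr_ge0 ?tpow_ge0 ?expR_ge0.
- by apply: integral_ge0 => t _; rewrite lee_fin mulr_ge0 ?tpow_ge0.
apply: eq_integral => w _.
have [w0|w0] := leP w 0.
  rewrite [in RHS]le0_tpow // mul0r mul0e; apply: integral0_eq => s _.
  have [s0|s0] := leP s 0; first by rewrite le0_tpow // !mul0r.
  by rewrite (le0_tpow (b - 1)) ?mulr0 ?mul0r // subr_le0 (le_trans w0) // ltW.
rewrite (@ge0_integral_scale _ w) //; last 2 first.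
- measurability_tac.
- by move=> s; rewrite lee_fin !mulr_ge0 ?tpow_ge0 ?expR_ge0.
rewrite -!ge0_integralZl //; last 6 first.
- measurability_tac.
- by move=> t _; rewrite lee_fin mulr_ge0 ?tpow_ge0.
- by rewrite lee_fin mulr_ge0 ?tpow_ge0 ?expR_ge0.
- measurability_tac.
- by move=> t _; rewrite lee_fin !mulr_ge0 ?tpow_ge0 ?expR_ge0.
- by rewrite lee_fin ltW.
apply: eq_integral => q _; rewrite -!EFinM; congr EFin.
rewrite (_ : w - w * q = w * (1 - q)); last by ring.
rewrite !tpowZ // (gt0_tpow _ _ w0).
have -> : w `^ (a + b - 1) = w * (w `^ (a - 1) * w `^ (b - 1)).
  rewrite -[X in X * (_ * _)]powRr1 ?(ltW w0) // -!gt0_powRD //.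
  by congr (_ `^ _); ring.
by ring.
Qed.

End gamma.

Section gamma2.
Context {R : realType}.
Local Notation mu := (@lebesgue_measure R).
Implicit Types (a b c r s t x y : R).

Lemma integral_tpow s (f : R -> R) :
  (\int[mu]_t (tpow s t * f t)%:E =
   \int[mu]_(t in `]0%R, +oo[) (t `^ s * f t)%:E)%E.
Proof.
rewrite [RHS]integral_mkcond; apply: eq_integral => t _.
rewrite patchE mem_setE in_itv /= andbT /tpow.
by case: ifP => // _; rewrite mul0r.
Qed.

Lemma powR_continuous s x : 0 < x -> t `^ s @[t --> x] --> x `^ s.
Proof.
move=> x0; have : derivable (fun t : R => t `^ s) x 1.
  by apply: derivable_powR; rewrite in_itv /= x0.
by move=> /derivable1_diffP/differentiable_continuous.
Qed.

Lemma integral_powR_1y a : 0 < a ->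
  (\int[mu]_(t in `[1%R, +oo[) (t `^ (- (a + 1)))%:E = (a^-1)%:E)%E.
Proof.
move=> a0.
rewrite (@ge0_continuous_FTC2y _ _ (fun t => - a^-1 * t `^ (- a)) _ 0) //.
- by rewrite powR1 mulr1 EFinN oppeK add0e.
- by move=> x x1; exact: powR_ge0.
- apply/continuous_within_itvcyP; split.
    move=> x; rewrite in_itv /= andbT => x1.
    by apply: powR_continuous; rewrite (lt_trans ltr01).
  exact/cvg_at_right_filter/powR_continuous.
- apply/cvgrPdist_lt => e e0; near=> t.
  have t0 : 0 < t by near: t; exact: nbhs_pinfty_gt.
  rewrite sub0r normrN mulNr normrN ger0_norm; last first.
    by rewrite mulr_ge0 ?invr_ge0 ?powR_ge0 // ltW.
  rewrite mulrC ltr_pdivrMr // powRN invf_plt ?posrE ?mulr_gt0 ?powR_gt0 //.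
  (* With both sides written as a-th powers, the condition on t becomes a lower bound by a constant,
     true near infinity. *)
  have -> : (e * a)^-1 = ((e * a) `^ (- a^-1)) `^ a.
    rewrite -powRrM mulNr mulVf ?gt_eqF // powR_inv1 // mulr_ge0 // ltW //.
  apply: gt0_ltr_powR => //; rewrite ?nnegrE ?powR_ge0 ?(ltW t0) //.
- move=> x x1; apply: derivableM => //.
  by apply: derivable_powR; rewrite in_itv /= andbT (lt_trans _ x1).
- apply: cvgM; first exact: cvg_cst.
  exact/cvg_at_right_filter/powR_continuous.
- move=> x; rewrite in_itv /= andbT => x1.
  have x_gt0 : 0 < x by rewrite (lt_trans ltr01).
  rewrite derive1E deriveM //; last first.
    exact: (@ex_derive _ _ _ _ _ _ _ (is_derive1_powR _ x_gt0)).
  rewrite (@derive_val _ _ _ _ _ _ _ (is_derive1_powR _ x_gt0)).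
  rewrite derive_cst scaler0 addr0.
  rewrite /GRing.scale /= mulrA mulrNN mulVf ?gt_eqF // mul1r opprD //.
Unshelve. all: by end_near. Qed.

Lemma eGamma1 : eGamma 1 = 1%E :> \bar R.
Proof.
rewrite -(integral_exponential_pdf (@ltr01 R)) /eGamma integral_tpow.
rewrite integral_itv_obnd_cbnd.
  rewrite [RHS](_ : _ =
    (\int[mu]_t ((fun t => (1 * expR (- 1 * t))%:E) \_ `[0%R, +oo[) t)%E).
    rewrite -integral_mkcond; apply: eq_integral => t _.
    by rewrite subrr powRr0 mulN1r.
  apply: eq_integral => t _; rewrite /exponential_pdf !patchE.
  by case: ifP.
measurability_tac.
Qed.

(** No integration by parts: this is [eGammaM_Beta2] at b = 1, where the Beta integral, shifted by
    1, is that of t^(- (a + 1)) over t > 1, equal to 1/a. *)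
Lemma eGammaS a : 0 < a -> eGamma (a + 1) = (a%:E * eGamma a)%E.
Proof.
move=> a0; have : (\int[mu]_t (tpow (1 - 1) t * (1 + t) `^ (- (a + 1)))%:E)%E =
    (a^-1)%:E.
  transitivity (\int[mu]_t (tpow 0 (t - 1) * t `^ (- (a + 1)))%:E)%E.
    rewrite -[RHS](@ge0_integral_translate _ 1); last 2 first.
    - measurability_tac.
    - by move=> t; rewrite lee_fin mulr_ge0 ?tpow_ge0 ?powR_ge0.
    by apply: eq_integral => t _; rewrite subrr addrK addrC.
  rewrite -integral_powR_1y // -integral_itv_obnd_cbnd; last first.
    by apply: measurable_funTS; measurability_tac.
  rewrite [RHS]integral_mkcond; apply: eq_integral => t _.
  rewrite patchE mem_setE in_itv /= andbT /tpow subr_gt0.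
  by case: ifP => _; rewrite ?powRr0 ?mul1r ?mul0r.
move=> E; have := eGammaM_Beta2 a 1; rewrite E eGamma1 mule1 => ->.
by rewrite muleCA -EFinM divff ?gt_eqF // mule1.
Qed.

(** [tpow 0 (t - x)] is the indicator of x < t, so an exponential becomes an integral of indicators,
    ready for Tonelli. *)
Lemma integral_exp_tail x :
  (\int[mu]_t (tpow 0 (t - x) * expR (- t))%:E = (expR (- x))%:E)%E.
Proof.
rewrite -(@ge0_integral_translate _ x); last 2 first.
- measurability_tac.
- by move=> t; rewrite lee_fin mulr_ge0 ?tpow_ge0 ?expR_ge0.
rewrite -[RHS]mule1 -eGamma1 -ge0_integralZl //; last 2 first.
- measurability_tac.
- by move=> t _; rewrite lee_fin mulr_ge0 ?tpow_ge0 ?expR_ge0.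
apply: eq_integral => t _; rewrite addrK subrr -EFinM opprD expRD; congr EFin.
by ring.
Qed.

(** After one step of the recurrence the integrand is at least exp(- t) on t > 1, whose integral is
    exp(- 1). *)
Lemma eGamma_gt0 a : 0 < a -> (0 < eGamma a)%E.
Proof.
move=> a0; suff : (0 < eGamma (a + 1))%E.
  by rewrite eGammaS // pmule_rgt0 // lte_fin.
apply: (@lt_le_trans _ _ (expR (- 1))%:E); first by rewrite lte_fin expR_gt0.
rewrite -integral_exp_tail; apply: ge0_le_integral => //.
- by move=> t _; rewrite lee_fin mulr_ge0 ?tpow_ge0 ?expR_ge0.
- measurability_tac.
- measurability_tac.
move=> t _; rewrite lee_fin ler_wpM2r ?expR_ge0 // addrK /tpow subr_gt0.
case: ltP => [t1|_]; last by case: ifP => // _; exact: powR_ge0.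
by rewrite (lt_trans ltr01 t1) powRr0 -(powRr0 t) ler_powR // ltW.
Qed.

Lemma eGamma_nat_lty n : (eGamma (n.+1%:R) < +oo :> \bar R)%E.
Proof.
elim: n => [|n IH]; first by rewrite eGamma1 ltry.
by rewrite -addn1 natrD eGammaS ?ltr0n // lte_mul_pinfty // lee_fin ler0n.
Qed.

Lemma eGamma_lty a : 0 < a -> (eGamma a < +oo)%E.
Proof.
move=> a0; suff : (eGamma (a + 1) < +oo)%E.
  rewrite eGammaS // !ltey; apply: contra => /eqP ->.
  by rewrite mulry gtr0_sg // mul1e.
(* Since 0 < a < n, t^a is at most 1 + t^n for every t > 0; the two terms are the integrands of
   Gamma at 1 and at n + 1. *)
pose n := (Num.truncn a).+1.
apply: (@le_lt_trans _ _ (eGamma 1 + eGamma (n.+1%:R))%E); last first.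
  by rewrite lte_add_pinfty // ?eGamma1 ?ltry // eGamma_nat_lty.
rewrite -ge0_integralD //; last 4 first.
- by move=> t _; rewrite lee_fin mulr_ge0 ?tpow_ge0 ?expR_ge0.
- measurability_tac.
- by move=> t _; rewrite lee_fin mulr_ge0 ?tpow_ge0 ?expR_ge0.
- measurability_tac.
apply: ge0_le_integral => //.
- by move=> t _; rewrite lee_fin mulr_ge0 ?tpow_ge0 ?expR_ge0.
- measurability_tac.
- by apply: emeasurable_funD; measurability_tac.
move=> t _; rewrite lee_fin -mulrDl ler_wpM2r ?expR_ge0 // /tpow.
have [_|t0] := leP t 0; first by rewrite addr0.
rewrite subrr powRr0 addrK -[n.+1%:R]natr1 addrK.
have [t1|t1] := leP t 1.
  apply: (@le_trans _ _ 1); last by rewrite lerDl powR_ge0.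
  by rewrite -(powRr0 t) ger_powR // ?t0 // ltW.
apply: (@le_trans _ _ (t `^ n%:R)); last by rewrite lerDr.
by rewrite ler_powR ?(ltW t1) // ltW // truncnS_gt.
Qed.

End gamma2.

(** * Gaussian integrals *)

Section gaussian.
Context {R : realType}.
Local Notation mu := (@lebesgue_measure R).
Implicit Types (a b c p r s t x y : R).

Lemma eGamma_fin_num a : 0 < a -> eGamma a \is a fin_num.
Proof. by move=> a0; rewrite ge0_fin_numE ?eGamma_ge0 // eGamma_lty. Qed.

(** Gamma(a) is positive and finite, so it cancels in [eGammaM_Beta] at b = 1; an infinite Beta
    value would make the right side infinite. *)
Lemma eBeta_r1 a : 0 < a -> eBeta a 1 = (a^-1)%:E.
Proof.
move=> a0; have := eGammaM_Beta a 1; rewrite eGamma1 mule1 eGammaS //.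
have := eGamma_gt0 _ a0; have := eGamma_fin_num _ a0.
have : (0 <= eBeta a 1)%E.
  by apply: integral_ge0 => t _; rewrite lee_fin mulr_ge0 ?tpow_ge0.
case: (eGamma a) => // g; case: (eBeta a 1) => [b||] // _ _.
  rewrite lte_fin => g0 [E]; congr EFin.
  have ag0 : a * g != 0 by rewrite mulf_neq0 // gt_eqF.
  by apply: (mulfI ag0); rewrite -E mulrAC divff ?mul1r ?gt_eqF.
by rewrite lte_fin => g0; rewrite -EFinM mulry gtr0_sg ?mulr_gt0 // mul1e.
Qed.

(** The substitution s = t^2 is not affine, so a layer-cake argument replaces it: exp(- t^2) is the
    integral of exp(- s) over s > t^2. After the swap, t^p integrated up to sqrt(s) gives s^((p +
    1)/2) / (p + 1), and the recurrence for Gamma finishes. *)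
Lemma gaussian_moment p : 0 <= p ->
  (\int[mu]_t (tpow p t * expR (- (t ^+ 2)))%:E =
   (2^-1)%:E * eGamma ((p + 1) / 2))%E.
Proof.
move=> p0.
transitivity (\int[mu]_t \int[mu]_s
    (tpow p t * (tpow 0 (s - t ^+ 2) * expR (- s)))%:E)%E.
  apply: eq_integral => t _; under eq_integral do rewrite EFinM.
  rewrite ge0_integralZl //; last 3 first.
  - measurability_tac.
  - by move=> s _; rewrite lee_fin mulr_ge0 ?tpow_ge0 ?expR_ge0.
  - by rewrite lee_fin tpow_ge0.
  by rewrite integral_exp_tail EFinM.
rewrite tonelli_swap; last 2 first.
- measurability_tac.
- by move=> s t; rewrite lee_fin !mulr_ge0 ?tpow_ge0 ?expR_ge0.
have p1 : 0 < p + 1 by rewrite ltr_wpDl.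
have q0 : 0 < (p + 1) / 2 by rewrite divr_gt0.
transitivity ((p + 1)^-1%:E * eGamma ((p + 1) / 2 + 1))%E; last first.
  rewrite eGammaS // muleA -EFinM; congr (EFin _ * _)%E.
  by field; rewrite gt_eqF.
rewrite -ge0_integralZl //; last 3 first.
- measurability_tac.
- by move=> s _; rewrite lee_fin mulr_ge0 ?tpow_ge0 ?expR_ge0.
- by rewrite lee_fin invr_ge0 ltW.
apply: eq_integral => s _; have [s0|s0] := leP s 0.
  rewrite [in RHS]le0_tpow // mul0r mule0; apply: integral0_eq => t _.
  by rewrite (le0_tpow 0) ?mul0r ?mulr0 // subr_le0 (le_trans s0) // sqr_ge0.
(* Scaling t by c = sqrt(s) brings the inner integral to the unit interval, where it is
   [eBeta (p + 1) 1]. *)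
pose c := s `^ 2^-1; have c0 : 0 < c by exact: powR_gt0.
have c2 : c ^+ 2 = s by rewrite /c powR12_sqrt ?sqr_sqrtr ?(ltW s0).
rewrite (@ge0_integral_scale _ c) //; last 2 first.
- measurability_tac.
- by move=> t; rewrite lee_fin !mulr_ge0 ?tpow_ge0 ?expR_ge0.
rewrite -eBeta_r1 // [RHS]muleC /eBeta -!ge0_integralZl //; last 6 first.
- measurability_tac.
- by move=> t _; rewrite lee_fin mulr_ge0 ?tpow_ge0.
- by rewrite lee_fin mulr_ge0 ?tpow_ge0 ?expR_ge0.
- measurability_tac.
- by move=> t _; rewrite lee_fin !mulr_ge0 ?tpow_ge0 ?expR_ge0.
- by rewrite lee_fin ltW.
apply: eq_integral => q _; rewrite -!EFinM; congr EFin.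
have -> : s - (c * q) ^+ 2 = s * (1 - q ^+ 2) by rewrite exprMn c2; ring.
rewrite !tpowZ // powRr0 mul1r (gt0_tpow _ s) // addrK subrr addrK.
have -> : s `^ ((p + 1) / 2) = c * c `^ p.
  by rewrite mulrDl gt0_powRD // powRrM mul1r -/c [RHS]mulrC powRAC.
have [q_le0|q_gt0] := leP q 0.
  by rewrite (le0_tpow p q) // !(mulr0,mul0r).
have -> : tpow 0 (1 - q ^+ 2) = tpow 0 (1 - q).
  by rewrite /tpow !subr_gt0 expr_lt1 ?ltW // !powRr0.
by ring.
Qed.

Definition gaussian_mass c : \bar R := \int[mu]_t (expR (- (c * t ^+ 2)))%:E.

Lemma gaussian_scale c (g : R -> R) : 0 < c -> measurable_fun setT g ->
  (forall t, 0 <= g t) ->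
  (\int[mu]_t (g t * expR (- (c * t ^+ 2)))%:E =
   (c `^ (- 2^-1))%:E *
     \int[mu]_t (g (c `^ (- 2^-1) * t) * expR (- (t ^+ 2)))%:E)%E.
Proof.
move=> c0 mg g0; rewrite (@ge0_integral_scale _ (c `^ (- 2^-1))); last 3 first.
- exact: powR_gt0.
- measurability_tac.
- by move=> t; rewrite lee_fin mulr_ge0 ?expR_ge0.
congr (_ * _)%E; apply: eq_integral => t _; congr (_ * expR (- _))%:E.
rewrite exprMn mulrA -(powR_mulrn 2 (powR_ge0 c _)) -powRrM mulNr mulVf //.
by rewrite powR_inv1 ?(ltW c0) // divff ?mul1r // gt_eqF.
Qed.

Lemma gaussian_massE c : 0 < c ->
  gaussian_mass c = (c `^ (- 2^-1) * Num.sqrt pi)%:E.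
Proof.
move=> c0; rewrite EFinM -integralT_gauss /gaussian_mass.
have m1 : measurable_fun setT (fun _ : R => 1 : R) by exact: measurable_cst.
have := gaussian_scale c _ c0 m1 (fun=> ler01).
under eq_integral do rewrite mul1r.
under [X in _ = (_ * X)%E -> _]eq_integral do rewrite mul1r.
by [].
Qed.

(* A rotation of the plane, done by hand: complete the square in the exponent. *)
Lemma gaussian_integral2 c a b (h : R -> \bar R) : 0 < c ->
  measurable_fun setT h -> (forall t, 0 <= h t)%E ->
  (\int[mu]_r \int[mu]_t (h (a * r + b * t)%R *
      (expR (- (c * t ^+ 2)))%:E * (expR (- (c * r ^+ 2)))%:E) =
   gaussian_mass c *
   \int[mu]_t (h (Num.sqrt (a ^+ 2 + b ^+ 2) * t)%R *
     (expR (- (c * t ^+ 2)))%:E))%E.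
Proof.
move=> c0 mh h0.
have E0 x : (0 <= (expR x)%:E)%E by rewrite lee_fin expR_ge0.
(* The substitution below divides by a. When a = 0 the integral factors already, and a negative b is
   reflected into |b|. *)
have [->|a0] := eqVneq a 0.
  rewrite expr0n add0r sqrtr_sqr.
  transitivity (gaussian_mass c * \int[mu]_t (h (b * t)%R *
     (expR (- (c * t ^+ 2)))%:E))%E.
    rewrite muleC -ge0_integralZl //; last 2 first.
    - measurability_tac.
    - by apply: integral_ge0 => t _; rewrite mule_ge0.
    apply: eq_integral => r _; rewrite -ge0_integralZr //; last 2 first.
    - measurability_tac.
    - by move=> t _; rewrite mule_ge0.
    by apply: eq_integral => t _; rewrite mul0r add0r.
  congr (_ * _)%E; have [b0|b0] := leP 0 b; first by rewrite ger0_norm.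
  rewrite ltr0_norm //.
  pose g t := (h (- b * t)%R * (expR (- (c * t ^+ 2)))%:E)%E.
  have mg : measurable_fun setT g by rewrite /g; measurability_tac.
  have g0 t : (0 <= g t)%E by rewrite mule_ge0.
  have N1 : -1 != 0 :> R by rewrite oppr_eq0 oner_eq0.
  have := ge0_integral_affine (-1) 0 g N1 mg g0.
  rewrite normrN1 invr1 mul1e => <-.
  by apply: eq_integral => t _; rewrite /g addr0 mulN1r mulrNN sqrrN.
rewrite tonelli_swap; last 2 first.
- measurability_tac.
- by move=> r t; rewrite !mule_ge0.
pose d := Num.sqrt (a ^+ 2 + b ^+ 2).
have d2 : d ^+ 2 = a ^+ 2 + b ^+ 2 by rewrite sqr_sqrtr // addr_ge0 ?sqr_ge0.
have d_gt0 : 0 < d by rewrite sqrtr_gt0 ltr_wpDr ?sqr_ge0 // exprn_even_gt0.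
have na0 : 0 < `|a| by rewrite normr_gt0.
(* For fixed t, w = a r + b t replaces r, so that h depends on w alone and leaves the integral over
   t. *)
transitivity (\int[mu]_t \int[mu]_w (`|a|^-1%:E * (h w *
    (expR (- (c * t ^+ 2)))%:E * (expR (- (c * ((w - b * t) / a) ^+ 2)))%:E)))%E.
  apply: eq_integral => t _.
  pose g w := (h w * (expR (- (c * t ^+ 2)))%:E *
    (expR (- (c * ((w - b * t) / a) ^+ 2)))%:E)%E.
  have mg : measurable_fun setT g by rewrite /g; measurability_tac.
  have g0 w : (0 <= g w)%E by rewrite !mule_ge0.
  transitivity (`|a|^-1%:E * \int[mu]_w g w)%E; last by rewrite -ge0_integralZl.
  rewrite -(ge0_integral_affine a (b * t) g a0 mg g0); apply: eq_integral => r _.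
  by rewrite /g addrK mulrAC divff // mul1r.
rewrite tonelli_swap; last 2 first.
- measurability_tac.
- by move=> t w; rewrite !mule_ge0 // lee_fin invr_ge0 ltW.
rewrite -/d [in RHS](_ : (\int[mu]_t _ = d^-1%:E *
    \int[mu]_w (h w * (expR (- (c * (w / d) ^+ 2)))%:E))%E); last first.
  rewrite [in RHS](@ge0_integral_scale _ d) //; last 2 first.
  - measurability_tac.
  - by move=> w; rewrite !mule_ge0.
  rewrite muleA -EFinM mulVf ?gt_eqF // mul1e; apply: eq_integral => t _.
  by rewrite mulrAC divff ?gt_eqF // mul1r.
rewrite muleA -ge0_integralZl //; last 3 first.
- measurability_tac.
- by move=> w _; rewrite !mule_ge0.
- by rewrite mule_ge0 ?lee_fin ?invr_ge0 ?(ltW d_gt0) ?integral_ge0.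
apply: eq_integral => w _.
transitivity (\int[mu]_t (`|a|^-1%:E * h w * (expR (- (c * (w / d) ^+ 2)))%:E *
    (expR (- (c * (d / a * t + - (b * w / (a * d))) ^+ 2)))%:E))%E.
  apply: eq_integral => t _; rewrite -!muleA; congr (_ * (_ * _))%E.
  rewrite -!EFinM -!expRD; congr (expR _)%:E.
  rewrite -!opprD -!mulrDr; congr (- (c * _)).
  have -> : t ^+ 2 + ((w - b * t) / a) ^+ 2 =
      ((a ^+ 2 + b ^+ 2) * t ^+ 2 - 2 * b * w * t + w ^+ 2) / a ^+ 2.
    by field.
  rewrite -d2.
  have -> : w ^+ 2 = w ^+ 2 * ((a ^+ 2 + b ^+ 2) / d ^+ 2).
    by rewrite d2 divff ?mulr1 // -d2 expf_neq0 // gt_eqF.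
  by field; rewrite a0 gt_eqF.
have dadiv : d / a != 0 by rewrite mulf_neq0 ?invr_eq0 // gt_eqF.
rewrite ge0_integralZl //; last 2 first.
- measurability_tac.
- by rewrite !mule_ge0 // lee_fin invr_ge0 ltW.
rewrite (@ge0_integral_affine _ (d / a) _
  (fun t => (expR (- (c * t ^+ 2)))%:E)) //; last first.
  measurability_tac.
rewrite -/(gaussian_mass c) normrM normfV (gtr0_norm d_gt0) invf_div.
have -> : (d^-1%:E = `|a|^-1%:E * (`|a| / d)%:E)%E.
  by rewrite -EFinM mulrA mulVf ?mul1r ?gt_eqF.
by rewrite mule.[AC (3 * 2) (5 * (1 * 4) * (2 * 3))].
Qed.

End gaussian.

(** * Gaussian integrals over row vectors *)

Section row_vectors.
Context {R : realType}.
Local Notation mu := (@lebesgue_measure R).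

Lemma cons_rV0 n (r : R) (y : 'rV[R]_n) : cons_rV (r, y) ord0 ord0 = r.
Proof.
rewrite /cons_rV /= mxE; case: splitP => [j _|j /= /eqP]; last by rewrite add1n.
by rewrite (ord1 j) mxE eqxx mulr1n.
Qed.

Lemma cons_rVS n (r : R) (y : 'rV[R]_n) j :
  cons_rV (r, y) ord0 (lift ord0 j) = y ord0 j.
Proof.
rewrite /cons_rV /= mxE; case: splitP => [k /= |k /= /eqP].
  by move=> /eqP; rewrite /bump /= (ord1 k).
by rewrite /bump /= eqSS => /eqP jk; congr (y _ _); exact/val_inj.
Qed.

Lemma dotp_cons n (a : 'rV[R]_n.+1) r (y : 'rV[R]_n) :
  dotp a (cons_rV (r, y)) =
  a ord0 ord0 * r + dotp (\row_j a ord0 (lift ord0 j)) y.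
Proof.
rewrite /dotp big_ord_recl cons_rV0; congr (_ + _).
by apply: eq_bigr => j _; rewrite cons_rVS mxE.
Qed.

Lemma dotp_cons2 n r (y : 'rV[R]_n) :
  dotp (cons_rV (r, y)) (cons_rV (r, y)) = r ^+ 2 + dotp y y.
Proof.
rewrite dotp_cons cons_rV0 -expr2; congr (_ + dotp _ _).
by apply/rowP => j; rewrite mxE cons_rVS.
Qed.

Lemma dotp_ge0 n (x : 'rV[R]_n) : 0 <= dotp x x.
Proof. by apply: sumr_ge0 => i _; rewrite -expr2 sqr_ge0. Qed.

Lemma integral_lebesgue_rVS n (f : borel_rV R n.+1 -> \bar R) :
  measurable_fun setT f -> (forall x, 0 <= f x)%E ->
  (\int[@lebesgue_rV R n.+1]_x f x =
   \int[mu]_r \int[@lebesgue_rV R n]_y f (cons_rV (r, y)))%E.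
Proof.
move=> mf f0; have mc := @measurable_cons_rV R n.
transitivity (\int[pushforward (mu \x @lebesgue_rV R n) (@cons_rV R n)]_x f x)%E.
  by apply: eq_measure_integral.
rewrite ge0_integral_pushforward // preimage_setT.
rewrite (fubini_tonelli1 (f \o @cons_rV R n)) //.
  exact: measurableT_comp.
by move=> x; exact: f0.
Qed.

(** A null set containing the origin, where the mixture formula for |x|^(- p) fails. *)
Lemma lebesgue_rV_hyperplane n :
  lebesgue_rV [set x : borel_rV R n.+1 | (x : 'rV[R]_n.+1) ord0 ord0 = 0] = 0%E.
Proof.
transitivity ((mu \x @lebesgue_rV R n) ([set 0%R] `*` setT))%E.
  congr (product_measure1 _ _ _); apply/seteqP.
  by split => -[r y] /=; rewrite cons_rV0 // => -[].
rewrite product_measure1E //.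
by rewrite [X in (X * _)%E](lebesgue_measure_set1 (0 : R)) mul0e.
Qed.

(** The marginal of a Gaussian along a, by induction on the dimension: the offset b absorbs the
    first coordinate, and [gaussian_integral2] then merges its coefficient with the norm of the
    remaining ones. The extra factor [gaussian_mass c] on the left avoids a division and makes
    dimension 0 true. *)
Lemma gaussian_rV n (a : 'rV[R]_n) (b c : R) (h : R -> \bar R) : 0 < c ->
  measurable_fun setT h -> (forall t, 0 <= h t)%E ->
  (gaussian_mass c * \int[@lebesgue_rV R n]_x
      (h (b + dotp a x)%R * (expR (- (c * dotp x x)))%:E) =
   ((c `^ (- 2^-1) * Num.sqrt pi) ^+ n)%:E *
     \int[mu]_t (h (b + enorm a * t)%R * (expR (- (c * t ^+ 2)))%:E))%E.
Proof.
move=> c0 mh h0.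
have E0 x : (0 <= (expR x)%:E :> \bar R)%E by rewrite lee_fin expR_ge0.
have m_int k x s : measurable_fun setT (fun y : borel_rV R k =>
    (h (s + dotp (x : 'rV[R]_k) y)%R * (expR (- (c * dotp (y : 'rV[R]_k) y)))%:E)%E).
  measurability_tac.
elim: n a b => [|n IH] a b.
  rewrite expr0 mul1e (_ : enorm a = 0); last first.
    by rewrite /enorm /dotp big_ord0 sqrtr0.
  rewrite integral_dirac //= ?diracT ?mul1e; last first.
    exact: m_int.
  rewrite /dotp !big_ord0 mulr0 oppr0 expR0 mule1 addr0 muleC.
  rewrite -ge0_integralZl //; last first.
    measurability_tac.
  by apply: eq_integral => t _; rewrite mul0r addr0.
rewrite integral_lebesgue_rVS; last 2 first.
- exact: m_int.
- by move=> x; rewrite mule_ge0.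
pose a' : 'rV[R]_n := \row_j a ord0 (lift ord0 j).
have fE r y : (h (b + dotp a (cons_rV (r, y)))%R *
    (expR (- (c * dotp (cons_rV (r, y)) (cons_rV (r, y)))))%:E =
    (expR (- (c * r ^+ 2)))%:E * (h (b + a ord0 ord0 * r + dotp a' y)%R *
    (expR (- (c * dotp y y)))%:E))%E.
  by rewrite dotp_cons2 mulrDr opprD expRD dotp_cons addrA EFinM muleCA.
have mg : (0 <= gaussian_mass c)%E.
  by apply: integral_ge0 => t _; rewrite lee_fin expR_ge0.
have g0 : (0 <= ((c `^ (- 2^-1) * Num.sqrt pi) ^+ n)%:E :> \bar R)%E.
  by rewrite lee_fin exprn_ge0 // mulr_ge0 ?powR_ge0 ?sqrtr_ge0.
transitivity (((c `^ (- 2^-1) * Num.sqrt pi) ^+ n)%:E *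
  \int[mu]_r \int[mu]_t (h (b + (a ord0 ord0 * r + enorm a' * t))%R *
      (expR (- (c * t ^+ 2)))%:E * (expR (- (c * r ^+ 2)))%:E))%E.
  rewrite -!ge0_integralZl //; last 4 first.
  - apply: tonelli_measurable; first by measurability_tac.
    by move=> r t; rewrite !mule_ge0.
  - by move=> r _; apply: integral_ge0 => t _; rewrite !mule_ge0.
  - apply: (tonelli_measurable (@lebesgue_rV R n) (fun r y =>
      (h (b + dotp a (cons_rV (r, y)))%R *
      (expR (- (c * dotp (cons_rV (r, y)) (cons_rV (r, y)))))%:E)%E)).
      apply: (@eq_measurable_fun _ _ _ _ _ ((fun y =>
        (h (b + dotp a y)%R * (expR (- (c * dotp y y)))%:E)%E) \o @cons_rV R n)).
        by case.
      exact: (measurableT_comp (m_int _ _ _) (@measurable_cons_rV R n)).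
    by move=> r y; rewrite mule_ge0.
  - by move=> r _; apply: integral_ge0 => t _; rewrite !mule_ge0.
  apply: eq_integral => r _.
  under [in LHS]eq_integral do rewrite fE.
  rewrite ge0_integralZl //; last by move=> x _; rewrite mule_ge0.
  rewrite muleCA IH muleCA ge0_integralZr //; last 2 first.
  - measurability_tac.
  - by move=> t _; rewrite mule_ge0.
  congr (_ * _)%E; rewrite muleC; congr (_ * _)%E.
  by apply: eq_integral => t _; rewrite addrA.
have mhb : measurable_fun setT (fun t => h (b + t)) by measurability_tac.
have := gaussian_integral2 c (a ord0 ord0) (enorm a') _ c0 mhb (fun t => h0 (b + t)).
move=> ->; rewrite muleA; congr (_ * _)%E.
  by rewrite gaussian_massE // -EFinM exprSr.
apply: eq_integral => t _; congr (h (b + Num.sqrt _ * t)%R * _)%E.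
rewrite /enorm sqr_sqrtr ?dotp_ge0 // /dotp [in RHS]big_ord_recl expr2.
congr (_ + _).
by apply: eq_bigr => j _; rewrite !mxE.
Qed.

End row_vectors.

(** * Rotations and the mean over the sphere *)

Section rotations.
Context {R : realType}.

(** Open sets are countable unions of rational balls, and a ball of the sup norm is a product of
    intervals. *)
Lemma measurable_fun_rV d (T : measurableType d) n (f : T -> borel_rV R n) :
  (forall i, measurable_fun setT (fun z => (f z : 'rV[R]_n) ord0 i)) ->
  measurable_fun setT f.
Proof.
move=> mf; apply: (@measurability _ _ _ (borel_rV R n) _ _ (@open 'rV[R]_n)) => //.
move=> _ [U oU <-]; rewrite setTI (open_rV_bigcup_ball oU).
rewrite preimage_bigcup bigcup_mkcond.
apply: countable_bigcupT_measurable => // z; case: ifPn => // _.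
set c : 'rV[R]_n := map_mx _ _; set r := ratr z.2.
(* A ball of nonpositive radius is empty, whereas in dimension 0 the intersection over coordinates
   would be everything. *)
have [r0|r0] := ltP 0 r; last first.
  rewrite (_ : _ @^-1` _ = set0) //; apply/seteqP; split => // x /= [r1 _].
  by move: r1; rewrite ltNge r0.
rewrite (_ : _ @^-1` _ = \bigcap_(j in [set: 'I_n])
    (fun z => (f z : 'rV[R]_n) ord0 j) @^-1` ball (c ord0 j) r).
  apply: fin_bigcap_measurable => // j _; rewrite -[X in measurable X]setTI.
  by apply: mf => //; exact: measurable_realfun.measurable_ball.
apply/seteqP; split => x /=.
  by move=> [_ h] j _; exact: h.
by move=> h; split=> // i j; rewrite (ord1 i); exact: h.
Qed.

Lemma dotpE n (u v : 'rV[R]_n) : dotp u v = (u *m v^T) ord0 ord0.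
Proof. by rewrite mxE; apply: eq_bigr => i _; rewrite mxE. Qed.

Lemma dotpC n (u v : 'rV[R]_n) : dotp u v = dotp v u.
Proof. by apply: eq_bigr => i _; rewrite mulrC. Qed.

Lemma dotpZr n c (u v : 'rV[R]_n) : dotp u (c *: v) = c * dotp u v.
Proof. by rewrite /dotp mulr_sumr; apply: eq_bigr => i _; rewrite mxE mulrCA. Qed.

Lemma dotp_eq0 n (u : 'rV[R]_n) : (dotp u u == 0) = (u == 0).
Proof.
apply/idP/eqP => [|->]; last by rewrite /dotp big1 // => i _; rewrite mxE mul0r.
rewrite /dotp psumr_eq0 => [/allP u0|i _]; last by rewrite -expr2 sqr_ge0.
apply/rowP => i; rewrite mxE; apply/eqP.
by have := u0 i (mem_index_enum i); rewrite mulf_eq0 orbb.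
Qed.

Lemma measurable_mulmx n (Q : 'M[R]_n) :
  measurable_fun setT (fun u : borel_rV R n => (u : 'rV[R]_n) *m Q : borel_rV R n).
Proof.
apply: measurable_fun_rV => j.
apply: (@eq_measurable_fun _ _ _ _ _
  (fun u : borel_rV R n => \sum_(i < n) (u : 'rV[R]_n) ord0 i * Q i j)).
  by move=> u _; rewrite mxE.
apply: measurable_sum => i; apply: measurable_realfun.measurable_funM => //.
exact: measurable_coord.
Qed.

(* A Householder reflection, composed with diag(1, ..., 1, -1) if its determinant
   is -1. *)
Lemma rotation_to n (v : 'rV[R]_n.+2) : dotp v v = 1 ->
  exists Q : 'M[R]_n.+2, [/\ Q *m Q^T = 1%:M, \det Q = 1 &
    delta_mx ord0 ord0 *m Q = v].
Proof.
move=> v1; pose e : 'rV[R]_n.+2 := delta_mx ord0 ord0.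
have e1 : dotp e e = 1.
  by rewrite dotpE trmx_delta mul_delta_mx mxE !eqxx.
suff [Q [QQ Qv]] : exists Q : 'M[R]_n.+2, Q *m Q^T = 1%:M /\ e *m Q = v.
  have : \det Q ^+ 2 = 1 by rewrite expr2 -{2}det_tr -det_mulmx QQ det1.
  move/eqP; rewrite sqrf_eq1 => /orP[/eqP dQ|/eqP dQ]; first by exists Q.
  (* The sign change hits the last coordinate, which differs from the first in dimension at least 2,
     so e stays fixed. *)
  pose d : 'rV[R]_n.+2 := \row_j (if j == ord_max then -1 else 1).
  exists (diag_mx d *m Q); split.
  - rewrite trmx_mul tr_diag_mx mulmxA -(mulmxA (diag_mx d)) QQ mulmx1.
    apply/matrixP => i j; rewrite mul_diag_mx !mxE.
    by have [->|] := eqVneq i j; rewrite ?mulr0n ?mulr0 //; case: ifP;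
      rewrite ?mulrNN !mulr1n ?mulr1.
  - rewrite det_mulmx dQ det_diag (bigD1 ord_max) //= mxE eqxx.
    rewrite big1 ?mulr1 ?mulrNN ?mulr1 //.
    by move=> i /negbTE ni; rewrite mxE ni.
  - rewrite mulmxA (_ : _ *m diag_mx d = e) //.
    by apply/matrixP => i j; rewrite mul_mx_diag !mxE /=;
       have [->|_] := eqVneq j ord0; rewrite ?andbF ?mul0r // mulr1.
have [->|ev] := eqVneq v e; first by exists 1%:M; rewrite trmx1 !mulmx1.
pose w := e - v.
have w0 : dotp w w != 0 by rewrite dotp_eq0 subr_eq0 eq_sym.
pose k := 2 / dotp w w.
have wwE : w *m w^T = (dotp w w)%:M by rewrite dotpE; exact: mx11_scalar.
(* As e and v are unit vectors, |w|^2 = 2 e . w; hence the reflection along w sends e to e - w =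
   v. *)
have ewE : dotp w w = 2 * dotp e w.
  have wE x : dotp x w = dotp x e - dotp x v.
    by rewrite /dotp -sumrB; apply: eq_bigr => i _; rewrite !mxE mulrBr.
  by rewrite wE [dotp w e]dotpC [dotp w v]dotpC !wE e1 v1 [dotp v e]dotpC; ring.
have [M ME] : exists M, M = w^T *m w by exists (w^T *m w).
have MM : M *m M = dotp w w *: M.
  by rewrite ME mulmxA -(mulmxA w^T) wwE mul_mx_scalar -scalemxAl.
exists (1%:M - k *: M); split.
  have -> : (1%:M - k *: M)^T = 1%:M - k *: M.
    rewrite ME; apply/matrixP => i j; rewrite !mxE eq_sym; congr (_ - k * _).
    by apply: eq_bigr => l _; rewrite !mxE mulrC.
  rewrite mulmxBl mul1mx mulmxBr mulmx1 -scalemxAl -scalemxAr MM !scalerA.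
  have -> : k * k * dotp w w = k + k by rewrite -mulrA [k * dotp w w]divfK //; ring.
  by rewrite scalerDl opprB addrK subrK.
rewrite mulmxBr mulmx1 -scalemxAr ME mulmxA.
have -> : e *m w^T = (dotp e w)%:M by rewrite dotpE; exact: mx11_scalar.
rewrite mul_scalar_mx scalerA /k.
have -> : 2 / dotp w w * dotp e w = 1.
  by rewrite mulrAC -ewE divff.
by rewrite scale1r /w opprB addrC subrK.
Qed.

End rotations.

Section sphere_measure.
Context {R : realType} {n : nat} (sigma : probability (borel_rV R n.+2) R).
Context (hsigma : is_sphere_measure sigma).
Local Notation mu := (@lebesgue_measure R).
Local Notation E := (borel_rV R n.+2).

Lemma measurable_enorm (d : measure_display) (T : measurableType d) (f : T -> E) :
  measurable_fun setT f -> measurable_fun setT (fun z => enorm (f z)).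
Proof.
move=> mf; apply: (@eq_measurable_fun _ _ _ _ _ (fun z => dotp (f z) (f z) `^ 2^-1)).
  by move=> z _; rewrite /enorm powR12_sqrt // dotp_ge0.
by apply: (measurableT_comp (@measurable_powR _ _)); exact: measurable_dotp.
Qed.

Lemma measurable_dotpl (x : 'rV[R]_n.+2) :
  measurable_fun setT (fun u : E => dotp (u : 'rV[R]_n.+2) x).
Proof. by apply: measurable_dotp; [exact: measurable_id|exact: measurable_cst]. Qed.

Lemma measurable_sphere : measurable (@sphere R n.+2 : set E).
Proof.
have := measurable_enorm _ _ _ (@measurable_id _ E setT) measurableT [set 1].
by rewrite setTI; apply; exact: measurable_set1.
Qed.

(** The sphere has full mass, so its complement is negligible. Passing back to the sphere later
    gives access to |u| = 1. *)
Lemma integral_sphere (f : E -> \bar R) : measurable_fun setT f ->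
  (forall u, 0 <= f u)%E ->
  (\int[sigma]_(u in sphere) f u = \int[sigma]_u f u)%E.
Proof.
move=> mf f0.
rewrite [RHS](@ge0_negligible_integral _ _ _ _ _ (~` (sphere : set E))) //.
- by rewrite setDE setCK setTI.
- by apply: measurableC; exact: measurable_sphere.
- apply: etrans (probability_setC sigma measurable_sphere) _.
  by rewrite [X in (1 - X)%E](proj1 hsigma) subee.
Qed.

(** For a rotation Q taking the first basis vector e to v, (u Q) . v = u . e. *)
Lemma sphere_measure_rotation (g : R -> \bar R) (v : 'rV[R]_n.+2) :
  measurable_fun setT g -> (forall t, 0 <= g t)%E -> dotp v v = 1 ->
  (\int[sigma]_u g (dotp u v) = \int[sigma]_u g (dotp u (delta_mx ord0 ord0)))%E.
Proof.
move=> mg g0 v1; have [Q [QQ dQ Qv]] := rotation_to _ v v1.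
have mQ := measurable_mulmx _ Q.
have mgd w : measurable_fun setT (fun u : E => g (dotp u w)).
  by apply: (measurableT_comp mg); exact: measurable_dotpl.
transitivity (\int[pushforward sigma (fun u : E => (u : 'rV[R]_n.+2) *m Q : E)]_u
   g (dotp u v))%E.
  by apply: eq_measure_integral => A mA _; exact/esym/(proj2 hsigma).
rewrite ge0_integral_pushforward // preimage_setT.
apply: eq_integral => u _ /=; congr g; rewrite !dotpE -Qv trmx_mul.
by rewrite mulmxA -(mulmxA _ Q) QQ mulmx1.
Qed.

Definition sphere_moment (p : R) : \bar R :=
  (\int[sigma]_u (tpow p (dotp u (delta_mx ord0 ord0)))%:E)%E.

Lemma enorm_ge0 k (x : 'rV[R]_k) : 0 <= enorm x.
Proof. exact: sqrtr_ge0. Qed.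

Lemma enorm_sqr k (x : 'rV[R]_k) : enorm x ^+ 2 = dotp x x.
Proof. by rewrite sqr_sqrtr // dotp_ge0. Qed.

Lemma enorm_eq0 k (x : 'rV[R]_k) : (enorm x == 0) = (x == 0).
Proof. by rewrite -dotp_eq0 -enorm_sqr sqrf_eq0. Qed.

Lemma measurable_tpow_dotp p (x : 'rV[R]_n.+2) :
  measurable_fun setT (fun u : E => (tpow p (dotp u x))%:E).
Proof. by measurability_tac. Qed.

(** For x nonzero, homogeneity of degree p reduces to the unit vector x / |x|; at x = 0 both sides
    vanish because p > 0. *)
Lemma integral_sphere_tpow p (x : 'rV[R]_n.+2) : 0 < p ->
  (\int[sigma]_u (tpow p (dotp u x))%:E = (enorm x `^ p)%:E * sphere_moment p)%E.
Proof.
move=> p0; have [->|x0] := eqVneq x 0.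
  rewrite (_ : enorm 0 = 0); last by apply/eqP; rewrite enorm_eq0.
  rewrite powR0 ?gt_eqF // mul0e; apply: integral0_eq => u _.
  by rewrite le0_tpow // /dotp big1 // => i _; rewrite mxE mulr0.
have ex0 : 0 < enorm x by rewrite lt_neqAle enorm_ge0 eq_sym enorm_eq0 x0.
pose v := (enorm x)^-1 *: x.
have v1 : dotp v v = 1.
  rewrite dotpZr dotpC dotpZr -enorm_sqr expr2.
  by rewrite mulKf ?gt_eqF // mulVf ?gt_eqF.
rewrite /sphere_moment -(sphere_measure_rotation (fun t => (tpow p t)%:E) v) //;
  last 2 first.
- apply/measurable_EFinP; exact: measurable_tpow.
- by move=> t; rewrite lee_fin tpow_ge0.
rewrite -ge0_integralZl //; last 3 first.
- by apply: measurable_tpow_dotp.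
- by move=> u _; rewrite lee_fin tpow_ge0.
- by rewrite lee_fin powR_ge0.
apply: eq_integral => u _; rewrite -EFinM -tpowZ // dotpZr.
by rewrite mulVKf // gt_eqF.
Qed.

(** The two terms of [phi] have disjoint supports, so its p-th power is a convex combination of
    t_+^p and (- t)_+^p. Both have the same mean, because - x has the norm of x, and the weights add
    up to 1. *)
Lemma integral_phi p tau (x : 'rV[R]_n.+2) : 1 <= p -> -1 <= tau -> tau <= 1 ->
  (\int[sigma]_u (phi p tau (dotp u x) `^ p)%:E =
   (enorm x `^ p)%:E * sphere_moment p)%E.
Proof.
move=> p1 tau1 tau2; have p0 : 0 < p by rewrite (lt_le_trans ltr01).
have phiE t : (phi p tau t `^ p)%:E =
    (((1 + tau) / 2)%:E * (tpow p t)%:E + ((1 - tau) / 2)%:E * (tpow p (- t))%:E)%E.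
  have t0 : 0 <= (1 + tau) / 2 by lra.
  have t1 : 0 <= (1 - tau) / 2 by lra.
  have rootK y : 0 <= y -> (y `^ p^-1) `^ p = y.
    by move=> y0; rewrite -powRrM mulVf ?gt_eqF // powRr1.
  rewrite -!EFinM -EFinD /phi; congr EFin.
  have [t_le0|t_gt0] := leP t 0; last first.
    rewrite (le0_tpow p (- t)) ?oppr_le0 ?(ltW t_gt0) // mulr0 addr0.
    rewrite max_r ?oppr_le0 ?(ltW t_gt0) // mulr0 addr0 gt0_tpow //.
    by rewrite powRM ?powR_ge0 ?(ltW t_gt0) // rootK.
  rewrite (le0_tpow p t) // !mulr0 !add0r max_l ?oppr_ge0 //.
  have [->|tn0] := eqVneq t 0.
    by rewrite oppr0 mulr0 powR0 ?gt_eqF // le0_tpow // mulr0.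
  have t_lt0 : 0 < - t by rewrite oppr_gt0 lt_neqAle tn0.
  by rewrite gt0_tpow // powRM ?powR_ge0 ?(ltW t_lt0) // rootK.
under eq_integral do rewrite phiE.
rewrite ge0_integralD //; last 4 first.
- by move=> u _; rewrite mule_ge0 ?lee_fin ?tpow_ge0 ?divr_ge0 //; lra.
- apply: emeasurable_funM => //; exact: measurable_tpow_dotp.
- by move=> u _; rewrite mule_ge0 ?lee_fin ?tpow_ge0 ?divr_ge0 //; lra.
- measurability_tac.
rewrite ge0_integralZl //; last 3 first.
- exact: measurable_tpow_dotp.
- by move=> u _; rewrite lee_fin tpow_ge0.
- by rewrite lee_fin; lra.
rewrite ge0_integralZl //; last 3 first.
- measurability_tac.
- by move=> u _; rewrite lee_fin tpow_ge0.
- by rewrite lee_fin; lra.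
rewrite integral_sphere_tpow //.
under eq_integral => u _ do rewrite -mulN1r -dotpZr.
rewrite integral_sphere_tpow // (_ : enorm (-1 *: x) = enorm x); last first.
  by rewrite /enorm dotpZr dotpC dotpZr mulN1r mulN1r opprK.
rewrite -ge0_muleDl ?lee_fin; last 2 first.
- lra.
- lra.
by rewrite -EFinD (_ : (1 + tau) / 2 + (1 - tau) / 2 = 1) ?mul1e //; field.
Qed.

End sphere_measure.

(** * The sphere moment from a Gaussian integral *)

(** Read from right to left, it inserts a nonzero finite factor, so that an identity known up to
    that factor can be applied. *)
Lemma mulKe {R : realFieldType} (r : R) (x : \bar R) : r != 0 ->
  (r^-1%:E * (r%:E * x) = x)%E.
Proof. by move=> r0; rewrite muleA -EFinM mulVf // mul1e. Qed.

Section moment.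
Context {R : realType} {n : nat} (sigma : probability (borel_rV R n.+2) R).
Context (hsigma : is_sphere_measure sigma).
Local Notation mu := (@lebesgue_measure R).
Local Notation E := (borel_rV R n.+2).
Local Notation lam := (@lebesgue_rV R n.+2).

Lemma sphere_moment_ge0 p : (0 <= sphere_moment sigma p)%E.
Proof. by apply: integral_ge0 => u _; rewrite lee_fin tpow_ge0. Qed.

Lemma gaussian_rV_mass :
  (\int[lam]_x (expR (- dotp x x))%:E = (Num.sqrt pi ^+ n.+2)%:E)%E.
Proof.
have mass0 : Num.sqrt pi != 0 :> R by rewrite gt_eqF // sqrtr_gt0 pi_gt0.
have m1 : measurable_fun setT (fun _ : R => 1%E : \bar R) by exact: measurable_cst.
rewrite -[LHS](mulKe _ _ mass0) -[RHS](mulKe _ _ mass0); congr (_ * _)%E.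
have -> : (Num.sqrt pi)%:E = gaussian_mass 1 :> \bar R.
  by rewrite gaussian_massE // powR1 mul1r.
transitivity (gaussian_mass 1 *
    \int[lam]_x (1 * (expR (- (1 * dotp x x)))%:E))%E.
  by congr (_ * _)%E; apply: eq_integral => x _; rewrite mul1e mul1r.
rewrite (gaussian_rV _ 0 0 _ (fun=> 1%E)) // powR1 mul1r muleC; congr (_ * _)%E.
by apply: eq_integral => t _; rewrite mul1e.
Qed.

Lemma gaussian_rV_moment p (c : R) (u : 'rV[R]_n.+2) : 0 < c -> 0 <= p ->
  enorm u = 1 ->
  (\int[lam]_x (tpow p (dotp u x) * expR (- (c * dotp x x)))%:E =
   (c `^ (- ((p + n.+2%:R) / 2)) * Num.sqrt pi ^+ n.+1 / 2)%:E *
     eGamma ((p + 1) / 2))%E.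
Proof.
move=> c0 p0 u1.
have pi0 : 0 < Num.sqrt pi :> R by rewrite sqrtr_gt0 pi_gt0.
have gm0 : c `^ (- 2^-1) * Num.sqrt pi != 0.
  by rewrite gt_eqF // mulr_gt0 // powR_gt0.
have mt : measurable_fun setT (fun t : R => (tpow p t)%:E).
  by apply/measurable_EFinP; exact: measurable_tpow.
rewrite -[LHS](mulKe _ _ gm0) -gaussian_massE //.
under eq_integral do rewrite EFinM -[dotp u _]add0r.
rewrite (gaussian_rV _ _ _ _ (fun t => (tpow p t)%:E)) //; last first.
  by move=> t; rewrite lee_fin tpow_ge0.
rewrite u1; under eq_integral do rewrite add0r mul1r -EFinM.
rewrite (gaussian_scale c (tpow p)) //; last 2 first.
- exact: measurable_tpow.
- by move=> t; exact: tpow_ge0.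
under eq_integral do rewrite tpowZ ?powR_gt0 // -mulrA EFinM.
rewrite ge0_integralZl //; last 3 first.
- measurability_tac.
- by move=> t _; rewrite lee_fin mulr_ge0 ?tpow_ge0 ?expR_ge0.
- by rewrite lee_fin powR_ge0.
rewrite gaussian_moment // !muleA -!EFinM; congr (EFin _ * _)%E.
rewrite exprS mulKf // exprMn -(powR_mulrn n.+1 (powR_ge0 c _)) -!powRrM.
(* The exponent collects - 1/2 for each of the n + 1 remaining directions, - 1/2 from rescaling the
   marginal and - p/2 from homogeneity. *)
rewrite (_ : - ((p + n.+2%:R) / 2) = - 2^-1 * n.+1%:R + - 2^-1 + - 2^-1 * p).
  by rewrite !gt0_powRD //; ring.
by rewrite -[n.+2%:R]natr1; field.
Qed.

Lemma sphere_moment_Gamma p : 1 <= p ->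
  (eGamma (p / 2) * sphere_moment sigma p * (Num.sqrt pi ^+ n.+2)%:E =
   (Num.sqrt pi ^+ n.+1 / 2)%:E * eGamma ((p + 1) / 2) *
     \int[mu]_t (tpow (p / 2 - 1) t * (1 + t) `^ (- ((p + n.+2%:R) / 2)))%:E)%E.
Proof.
move=> p1; have p0 : 0 < p by rewrite (lt_le_trans ltr01).
have mtd p' (x : 'rV[R]_n.+2) : measurable_fun setT
    (fun u : E => (tpow p' (dotp u x))%:E) by exact: measurable_tpow_dotp.
(* In 1 + l, the 1 is the Gaussian weight and l the mixture parameter. *)
pose F (x : E) (l : R) (u : E) := (tpow (p / 2 - 1) l * tpow p (dotp u x) *
   expR (- ((1 + l) * dotp x x)))%:E.
have F0 x l u : (0 <= F x l u)%E.
  by rewrite lee_fin !mulr_ge0 ?tpow_ge0 ?expR_ge0.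
have mF2 l : @measurable_fun _ _ (E * E)%type (\bar R) setT (fun z => F z.1 l z.2).
  by rewrite /F; measurability_tac.
have mF : @measurable_fun _ _ (E * R)%type (\bar R) setT
    (fun z => \int[sigma]_u F z.1 z.2 u)%E.
  apply: (tonelli_measurable sigma (fun z u => F z.1 z.2 u)) => //.
  by rewrite /F; measurability_tac.
transitivity (\int[lam]_x \int[mu]_l \int[sigma]_u F x l u)%E.
  rewrite -gaussian_rV_mass -ge0_integralZl //; last 2 first.
  - measurability_tac.
  - by rewrite mule_ge0 ?eGamma_ge0 ?sphere_moment_ge0.
  have mint : measurable_fun setT (fun x : E => \int[mu]_l \int[sigma]_u F x l u)%E.
    apply: (tonelli_measurable mu (fun x l => \int[sigma]_u F x l u)%E) => //.
    by move=> x l; exact: integral_ge0.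
  apply: ge0_ae_eq_integral => //.
  - apply: emeasurable_funM => //; measurability_tac.
  - move=> x _; rewrite !mule_ge0 ?eGamma_ge0 ?sphere_moment_ge0 //.
  - by move=> x _; apply: integral_ge0 => l _; exact: integral_ge0.
  (* Pointwise equality can fail at x = 0; a whole coordinate hyperplane is discarded with it. *)
  exists [set x : E | (x : 'rV[R]_n.+2) ord0 ord0 = 0]; split.
  - have := measurable_coord n.+2 ord0 measurableT [set 0 : R].
    by rewrite setTI; apply; exact: measurable_set1.
  - exact: lebesgue_rV_hyperplane.
  move=> x /= /not_implyP[_ xE]; apply: contrapT => x0; apply: xE.
  have {}x0 : 0 < enorm x.
    rewrite lt_neqAle enorm_ge0 eq_sym enorm_eq0 andbT; apply/eqP => xE.
    by apply: x0; rewrite xE mxE.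
  have x2 : 0 < dotp x x by rewrite -enorm_sqr exprn_gt0.
  transitivity (\int[mu]_l ((enorm x `^ p)%:E * sphere_moment sigma p *
      (expR (- dotp x x))%:E *
      (tpow (p / 2 - 1) l * expR (- (dotp x x * l)))%:E))%E.
    rewrite ge0_integralZl //; last 3 first.
    - measurability_tac.
    - by move=> l _; rewrite lee_fin mulr_ge0 ?tpow_ge0 ?expR_ge0.
    - by rewrite !mule_ge0 ?sphere_moment_ge0 // lee_fin ?powR_ge0 ?expR_ge0.
    rewrite eGamma_scale // -enorm_sqr -powR_mulrn ?enorm_ge0 // -powRrM.
    rewrite (_ : 2%:R * - (p / 2) = - p); last by field.
    rewrite mule.[AC (3 * 2) (4 * 1 * (5 * 2) * 3)] -EFinM.
    by rewrite powRN mulVf ?mul1e // gt_eqF // powR_gt0.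
  apply: eq_integral => l _.
  transitivity (\int[sigma]_u ((tpow (p / 2 - 1) l *
      expR (- ((1 + l) * dotp x x)))%:E * (tpow p (dotp u x))%:E))%E; last first.
    by apply: eq_integral => u _; rewrite /F -EFinM mulrAC.
  rewrite ge0_integralZl //; last 2 first.
  - by move=> u _; rewrite lee_fin tpow_ge0.
  - by rewrite lee_fin mulr_ge0 ?tpow_ge0 ?expR_ge0.
  rewrite integral_sphere_tpow // [RHS]muleC -[LHS]muleA; congr (_ * _)%E.
  rewrite mulrDl mul1r opprD expRD [l * _]mulrC -!EFinM; congr EFin; ring.
transitivity (\int[mu]_l \int[sigma]_u \int[lam]_x F x l u)%E.
  apply: etrans (tonelli_swap lam mu (fun x l => \int[sigma]_u F x l u)%E mF _) _.
    by move=> x l; exact: integral_ge0.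
  apply: eq_integral => l _.
  exact: (tonelli_swap lam sigma (fun x u => F x l u) (mF2 l)).
rewrite -ge0_integralZl //; last 3 first.
- measurability_tac.
- by move=> t _; rewrite lee_fin mulr_ge0 ?tpow_ge0 ?powR_ge0.
- by rewrite mule_ge0 ?eGamma_ge0 // lee_fin mulr_ge0 ?exprn_ge0 ?sqrtr_ge0.
apply: eq_integral => l _; have [l0|l0] := leP l 0.
  rewrite (le0_tpow _ l) // mul0r mule0; apply: integral0_eq => u _.
  by apply: integral0_eq => x _; rewrite /F le0_tpow // !mul0r.
(* [gaussian_rV_moment] needs |u| = 1, so u is confined to the sphere before the inner integral is
   evaluated. *)
rewrite -integral_sphere //; last 2 first.
- apply: (tonelli_measurable lam (fun u x => F x l u)%E) => //.
  rewrite /F; measurability_tac.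
- by move=> u; exact: integral_ge0.
transitivity (\int[sigma]_(u in sphere) ((tpow (p / 2 - 1) l)%:E *
  ((1 + l) `^ (- ((p + n.+2%:R) / 2)) * Num.sqrt pi ^+ n.+1 / 2)%:E *
     eGamma ((p + 1) / 2)))%E.
  apply: eq_integral => u; rewrite inE /= => u1.
  rewrite -muleA -(gaussian_rV_moment _ _ u) ?addr_gt0 ?(ltW p0) //.
  rewrite -ge0_integralZl //; last 3 first.
  - measurability_tac.
  - by move=> x _; rewrite lee_fin mulr_ge0 ?tpow_ge0 ?expR_ge0.
  - by rewrite lee_fin tpow_ge0.
  by apply: eq_integral => x _; rewrite -EFinM mulrA.
rewrite integral_cst /=; last exact: measurable_sphere.
rewrite [X in (_ * X)%E](proj1 hsigma) mule1 -!EFinM.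
rewrite [RHS]muleAC -EFinM; congr (EFin _ * _)%E; ring.
Qed.

End moment.

(** * The value of the constant *)

Section constant.
Context {R : realType}.
Local Notation mu := (@lebesgue_measure R).

Lemma eGammaE (a : R) : 0 < a -> eGamma a = (Gamma a)%:E.
Proof.
move=> a0; rewrite /Gamma /Rintegral -integral_tpow fineK //.
exact: eGamma_fin_num.
Qed.

Lemma Gamma_gt0 (a : R) : 0 < a -> 0 < Gamma a.
Proof. by move=> a0; rewrite -lte_fin -eGammaE // eGamma_gt0. Qed.

Lemma GammaS (a : R) : 0 < a -> Gamma (a + 1) = a * Gamma a.
Proof.
move=> a0; have := eGammaS a a0; rewrite !eGammaE ?addr_gt0 //.
by rewrite -EFinM => -[].
Qed.

Lemma eBetaE (a b : R) : 0 < a -> 0 < b ->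
  eBeta a b = (Gamma a * Gamma b / Gamma (a + b))%:E.
Proof.
move=> a0 b0; have g0 := Gamma_gt0 _ (addr_gt0 a0 b0).
rewrite -[LHS](mulKe (Gamma (a + b))) ?gt_eqF // -eGammaE ?addr_gt0 //.
by rewrite -eGammaM_Beta !eGammaE // -!EFinM mulrC.
Qed.

Lemma BetaE (a b : R) : 0 < a -> 0 < b ->
  Beta a b = Gamma a * Gamma b / Gamma (a + b).
Proof.
move=> a0 b0; rewrite -[RHS]/(fine _%:E) -eBetaE //; congr fine.
rewrite [LHS]integral_mkcond; apply: eq_integral => t _.
rewrite patchE mem_setE in_itv /= /tpow subr_gt0.
by case: ifP => [/andP[-> ->]//|]; case: (0 < t) => /= [->|_];
  rewrite ?mulr0 ?mul0r.
Qed.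

(** The recurrence for Gamma cancels the factors n - 1 and n against the volumes of the balls,
    Gamma((n - 1)/2) cancels between [omega] and [Beta], and the quotient of the powers of pi leaves
    1 / sqrt(pi). Here the dimension is [n.+2]. *)
Lemma capacity_constE n (p : R) : 1 <= p ->
  capacity_const n.+2 p = Gamma ((p + 1) / 2) * Gamma (n.+2%:R / 2) /
    (2 * Num.sqrt pi * Gamma (n.+2%:R / 2 + p / 2)).
Proof.
move=> p1; have p0 : 0 < p by rewrite (lt_le_trans ltr01).
have N0 : (0 : R) < n.+1%:R by rewrite ltr0n.
have NS : n.+2%:R = n.+1%:R + 1 :> R by rewrite natr1.
have pi0 := pi_gt0 R.
rewrite /capacity_const /omega /= NS addrK BetaE ?divr_gt0 ?addr_gt0 //.
rewrite ![1 + _]addrC !GammaS ?divr_gt0 ?addr_gt0 //.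
rewrite (_ : (n.+1%:R + 1) / 2 = n.+1%:R / 2 + 2^-1); last by field.
rewrite gt0_powRD // powR12_sqrt ?(ltW pi0) //.
rewrite (_ : (p + 1) / 2 + n.+1%:R / 2 = n.+1%:R / 2 + 2^-1 + p / 2); last by field.
have := Gamma_gt0 ((p + 1) / 2); have := Gamma_gt0 (n.+1%:R / 2).
have := Gamma_gt0 (n.+1%:R / 2 + 2^-1).
have := Gamma_gt0 (n.+1%:R / 2 + 2^-1 + p / 2).
rewrite !addr_gt0 ?divr_gt0 ?addr_gt0 ?invr_gt0 //.
move=> /(_ isT) g1 /(_ isT) g2 /(_ isT) g3 /(_ isT) g4.
have s0 : 0 < Num.sqrt pi :> R by rewrite sqrtr_gt0.
have q0 : 0 < pi `^ (n.+1%:R / 2) :> R by rewrite powR_gt0.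
move: g1 g2 g3 g4 s0 q0 N0.
move: (Gamma (n.+1%:R / 2 + 2^-1 + p / 2)) (Gamma (n.+1%:R / 2 + 2^-1))
  (Gamma (n.+1%:R / 2)) (Gamma ((p + 1) / 2)) (Num.sqrt pi) (pi `^ (n.+1%:R / 2)).
move: n.+1%:R => k G1 G2 G3 G4 r q G1_gt0 G2_gt0 G3_gt0 G4_gt0 r_gt0 q_gt0 k_gt0.
by field; rewrite !gt_eqF // addr_gt0.
Qed.

Lemma capacity_const_gt0 n (p : R) : 1 <= p -> 0 < capacity_const n.+2 p.
Proof.
move=> p1; have p0 : 0 < p by rewrite (lt_le_trans ltr01).
have N0 : (0 : R) < n.+2%:R by rewrite ltr0n.
have h1 : 0 < (p + 1) / 2 by rewrite divr_gt0 ?addr_gt0.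
have h2 : 0 < n.+2%:R / 2 :> R by rewrite divr_gt0.
have h3 : 0 < n.+2%:R / 2 + p / 2 by rewrite addr_gt0 ?divr_gt0.
by rewrite capacity_constE // divr_gt0 ?mulr_gt0 ?Gamma_gt0 ?sqrtr_gt0 ?pi_gt0.
Qed.

(** The integral over l left by [sphere_moment_Gamma] is that of [eGammaM_Beta2] at half the
    dimension and p/2; the factor Gamma(p/2) then cancels. *)
Lemma sphere_momentE n (sigma : probability (borel_rV R n.+2) R) (p : R) :
  is_sphere_measure sigma -> 1 <= p ->
  sphere_moment sigma p = (capacity_const n.+2 p)%:E.
Proof.
move=> hs p1; have p0 : 0 < p by rewrite (lt_le_trans ltr01).
have N0 : (0 : R) < n.+2%:R by rewrite ltr0n.
have g1 : 0 < Gamma (p / 2) by rewrite Gamma_gt0 ?divr_gt0.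
have g2 : 0 < Gamma (n.+2%:R / 2 + p / 2) by rewrite Gamma_gt0 ?addr_gt0 ?divr_gt0.
have s0 : 0 < Num.sqrt pi :> R by rewrite sqrtr_gt0 pi_gt0.
have := eGammaM_Beta2 (n.+2%:R / 2) (p / 2); have := sphere_moment_Gamma _ hs _ p1.
rewrite (_ : (p + n.+2%:R) / 2 = n.+2%:R / 2 + p / 2); last by field.
set X := integral _ _ _ => E1 E2.
have XE : X = (Gamma (n.+2%:R / 2) * Gamma (p / 2) / Gamma (n.+2%:R / 2 + p / 2))%:E.
  rewrite -[LHS](mulKe (Gamma (n.+2%:R / 2 + p / 2))) ?gt_eqF //.
  rewrite -eGammaE ?addr_gt0 ?divr_gt0 // -E2 !eGammaE ?divr_gt0 //.
  by rewrite -!EFinM mulrC.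
have k0 : Gamma (p / 2) * Num.sqrt pi ^+ n.+2 != 0.
  by rewrite mulf_neq0 ?expf_neq0 // gt_eqF.
rewrite -[LHS](mulKe _ _ k0) [in X in (_ * X)%E]EFinM muleAC -eGammaE ?divr_gt0 //.
rewrite E1 XE !eGammaE ?divr_gt0 ?addr_gt0 // -!EFinM capacity_constE //.
congr EFin; rewrite exprS; have := exprn_gt0 n.+1 s0; move: g1 g2 s0.
move: (Gamma (p / 2)) (Gamma (n.+2%:R / 2 + p / 2)) (Gamma (n.+2%:R / 2))
  (Gamma ((p + 1) / 2)) (Num.sqrt pi) (Num.sqrt pi ^+ n.+1).
move=> G1 G2 G3 G4 r q G1_gt0 G2_gt0 r_gt0 q_gt0.
by field; rewrite !gt_eqF.
Qed.

End constant.

(** * Comparison of the energies *)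

Section negative_power_mean.
Context {R : realType}.
Implicit Types (x y q : R).

Lemma eneg_pow_ge0 (x : \bar R) q : (0 <= eneg_pow x q)%E.
Proof. by rewrite /eneg_pow inve_ge0 poweR_ge0. Qed.

Lemma eneg_powE (x : \bar R) q : 0 < q -> (0 <= x)%E ->
  eneg_pow x q = if x == 0%E then +oo%E else
    if x == +oo%E then 0%E else (fine x `^ (- q))%:E.
Proof.
move=> q0; rewrite /eneg_pow; case: x => [x||] //; last first.
  by move=> _; rewrite poweRyr // gt_eqF.
rewrite lee_fin eqe => x0; case: eqVneq => [->|xn0].
  by rewrite poweR0r ?inve0 // gt_eqF.
by rewrite poweR_EFin inver powR_eq0 (negbTE xn0) /= powRN.
Qed.

Lemma measurable_eneg_pow d (T : measurableType d) (f : T -> \bar R) q :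
  0 < q -> (forall u, 0 <= f u)%E -> measurable_fun setT f ->
  measurable_fun setT (fun u => eneg_pow (f u) q).
Proof.
move=> q0 f0 mf.
apply: (@eq_measurable_fun _ _ _ _ _ (fun u => if f u == 0%E then +oo%E else
    if f u == +oo%E then 0%E else (fine (f u) `^ (- q))%:E)).
  by move=> u _; rewrite -eneg_powE.
have meq (c : \bar R) : measurable_fun setT (fun u => f u == c).
  apply: (measurable_fun_bool true).
  rewrite setTI (_ : _ @^-1` _ = f @^-1` [set c]); last first.
    by apply/seteqP; split => u /= /eqP.
  by rewrite -[X in measurable X]setTI; apply: mf => //; exact: emeasurable_set1.
apply: measurable_fun_ifT => //; apply: measurable_fun_ifT => //.
apply/measurable_EFinP; apply: (measurableT_comp (@measurable_powR _ _)).
exact: (measurableT_comp (@fine_measurable R setT measurableT) mf).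
Qed.

(* The tangent line of the convex function x `^ (- q) at y. *)
Lemma eneg_pow_tangent (x : \bar R) y q : 0 < q -> 0 < y -> (0 <= x)%E ->
  (((1 + q) * y `^ (- q))%:E <= eneg_pow x q + (q * y `^ (- q) / y)%:E * x)%E.
Proof.
move=> q0 y0 x0; rewrite eneg_powE //; have k0 : 0 < q * y `^ (- q) / y.
  by rewrite divr_gt0 ?mulr_gt0 ?powR_gt0.
case: eqVneq => [->|xn0]; first by rewrite mule0 adde0 leey.
case: x x0 xn0 => [x||] // x0 xn0; last first.
  by rewrite eqxx mulry gtr0_sg // mul1e add0e leey.
have {xn0}x_gt0 : 0 < x by rewrite lt_neqAle eq_sym -eqe xn0 -lee_fin.
rewrite /= -EFinM -EFinD lee_fin.
(* Homogeneity reduces to y = 1, where z^(- q) = exp(- q ln z) >= 1 - q ln z >= 1 - q (z - 1). *)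
pose z := x / y; have z0 : 0 < z by rewrite divr_gt0.
have -> : x `^ (- q) = y `^ (- q) * z `^ (- q).
  by rewrite -powRM ?(ltW y0) ?(ltW z0) // /z mulrCA divff ?mulr1 // gt_eqF.
rewrite [leRHS](_ : _ = y `^ (- q) * (z `^ (- q) + q * z)); last by rewrite /z; ring.
rewrite mulrC ler_pM2l ?powR_gt0 //.
have lnz : ln z <= z - 1.
  by rewrite -[X in ln X](subrKC 1) le_ln1Dx // ltrBrDl subrr.
have : 1 - q * ln z <= z `^ (- q).
  rewrite /powR gt_eqF // mulNr; exact: expR_ge1Dx.
have : q * ln z <= q * (z - 1) by rewrite ler_pM2l.
lra.
Qed.

(** The tangent is taken at an arbitrary positive y above the mean rather than at the mean, which
    may be 0; then y decreases to the mean. An infinite mean is trivial. *)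
Lemma negative_power_mean_le d (T : measurableType d) (P : probability T R)
    (f : T -> \bar R) q : 0 < q -> (forall u, 0 <= f u)%E ->
  measurable_fun setT f ->
  (eneg_pow (\int[P]_u eneg_pow (f u) q) q^-1 <= \int[P]_u f u)%E.
Proof.
move=> q0 f0 mf; have mef := measurable_eneg_pow _ _ _ _ q0 f0 mf.
set Y := (\int[P]_u f u)%E; have Y0 : (0 <= Y)%E by exact: integral_ge0.
suff H y : 0 < y -> (Y <= y%:E)%E ->
    (eneg_pow (\int[P]_u eneg_pow (f u) q) q^-1 <= y%:E)%E.
  case EY : Y Y0 H => [y||] // Y0 H; last by rewrite leey.
  apply/lee_addgt0Pr => e e0; apply: H; first by rewrite ltr_wpDl.
  by rewrite lee_fin lerDl ltW.
move=> y0 Yy; set X := (\int[P]_u eneg_pow (f u) q)%E.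
have X0 : (0 <= X)%E by apply: integral_ge0 => u _; exact: eneg_pow_ge0.
pose k := q * y `^ (- q) / y.
have k0 : 0 < k by rewrite divr_gt0 ?mulr_gt0 ?powR_gt0.
(* The tangent inequality integrated over a probability. With Y <= y the last term is at most q y^(-
   q), which leaves y^(- q) <= X. *)
have : (((1 + q) * y `^ (- q))%:E <= X + k%:E * Y)%E.
  rewrite -ge0_integralZl //; last by rewrite lee_fin ltW.
  rewrite -ge0_integralD //; last 3 first.
  - by move=> u _; exact: eneg_pow_ge0.
  - by move=> u _; rewrite mule_ge0 // lee_fin ltW.
  - exact: emeasurable_funM.
  rewrite -[X in (X <= _)%E]mule1 -(probability_setT P) -integral_cst //.
  apply: ge0_le_integral => //.
  - by move=> u _; rewrite lee_fin mulr_ge0 ?powR_ge0 // addr_ge0 // ltW.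
  - by apply: emeasurable_funD => //; exact: emeasurable_funM.
  - by move=> u _; exact: eneg_pow_tangent.
move=> /le_trans/(_ (leeD2l X (lee_wpmul2l _ Yy))).
rewrite lee_fin => /(_ (ltW k0)).
rewrite -EFinM (_ : k * y = q * y `^ (- q)); last by rewrite divfK // gt_eqF.
rewrite mulrDl mul1r EFinD leeD2rE // => Xy.
rewrite /eneg_pow inve_ple ?inE ?poweR_ge0 ?lee_fin ?(ltW y0) //; last first.
apply: (@le_trans _ _ ((y `^ (- q))%:E `^ q^-1)%E).
  rewrite poweR_EFin -powRrM mulNr divff ?gt_eqF // powR_inv1 ?(ltW y0) //.
  by rewrite inver gt_eqF.
apply: gt0_ler_poweR => //; rewrite ?in_itv /= ?invr_ge0 ?(ltW q0) ?leey ?andbT //.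
by rewrite lee_fin powR_ge0.
Qed.

End negative_power_mean.

Section energy.
Context {R : realType} {n : nat} (sigma : probability (borel_rV R n.+2) R).
Context (hsigma : is_sphere_measure sigma).
Local Notation E := (borel_rV R n.+2).

Lemma measurable_phi (p tau : R) : measurable_fun setT (phi p tau).
Proof.
apply: measurable_realfun.measurable_funD;
  apply: measurable_realfun.measurable_funM => //;
  apply: measurable_maxr => //; exact: oppr_measurable.
Qed.

Lemma measurable_grad (f : 'rV[R]_n.+2 -> R) : smooth f ->
  measurable_fun setT (fun x : E => grad f x : E).
Proof.
move=> sf; apply: measurable_fun_rV => i.
apply: (@eq_measurable_fun _ _ _ _ _ (partial i f : E -> R)).
  by move=> x _; rewrite mxE.
by apply: measurable_continuous_rV; have [_ /(_ i)[_ []]] := sf 1%N.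
Qed.

Lemma affine_energy_le (f : 'rV[R]_n.+2 -> R) (p tau : R) : 1 <= p ->
  -1 <= tau -> tau <= 1 -> smooth f ->
  (affine_energy sigma p tau f <=
   (capacity_const n.+2 p)%:E * dirichlet_energy p f)%E.
Proof.
move=> p1 tau1 tau2 sf; have p0 : 0 < p by rewrite (lt_le_trans ltr01).
have mg := measurable_grad _ sf.
pose F (u x : E) := (phi p tau (dotp u (grad f x)) `^ p)%:E.
have F0 u x : (0 <= F u x)%E by rewrite lee_fin powR_ge0.
have mF : @measurable_fun _ _ (E * E)%type (\bar R) setT (fun z => F z.1 z.2).
  apply/measurable_EFinP; apply: (measurableT_comp (@measurable_powR _ p)).
  apply: (measurableT_comp (measurable_phi p tau)).
  apply: measurable_dotp; first exact: measurable_fst.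
  exact: (measurableT_comp mg measurable_snd).
have q0 : 0 < n.+2%:R / p by rewrite divr_gt0 // ltr0n.
have mI := tonelli_measurable (@lebesgue_rV R n.+2) F mF F0.
have I0 u : (0 <= \int[@lebesgue_rV R n.+2]_x F u x)%E by exact: integral_ge0.
rewrite /affine_energy integral_sphere //; last 2 first.
- exact: measurable_eneg_pow.
- by move=> u; exact: eneg_pow_ge0.
(* The outer exponent is the inverse of q = n / p, as the power mean inequality requires. *)
rewrite -[p / n.+2%:R]invf_div.
apply: le_trans (negative_power_mean_le _ _ sigma _ _ q0 I0 mI) _.
rewrite tonelli_swap // /dirichlet_energy.
under eq_integral do rewrite integral_phi //.
have mD : measurable_fun setT (fun x : E => (enorm (grad f x) `^ p)%:E).
  apply/measurable_EFinP; apply: (measurableT_comp (@measurable_powR _ p)).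
  exact: measurable_enorm.
have D0 (x : E) : setT x -> (0 <= (enorm (grad f x) `^ p)%:E)%E.
  by rewrite lee_fin powR_ge0.
have A0 : (0 <= (capacity_const n.+2 p)%:E)%E.
  by rewrite lee_fin ltW // capacity_const_gt0.
rewrite (sphere_momentE _ _ _ hsigma p1) (ge0_integralZr _ measurableT mD D0 A0).
by rewrite muleC.
Qed.

End energy.

(** * Comparison of the capacities *)

Theorem theorem5p1 (R : realType) (n : nat) (n_ge2 : (2 <= n)%N)
    (p : R) (p_ge1 : 1 <= p) (p_ltn : p < n%:R)
    (sigma : probability (borel_rV R n) R) (hsigma : is_sphere_measure sigma)
    (K : set 'rV[R]_n) (cK : compact K)
    (tau : R) (tau_geN1 : -1 <= tau) (tau_le1 : tau <= 1) :
  (affine_capacity sigma p tau K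
     <= (capacity_const n p)%:E * variational_capacity p K)%E.
Proof.
case: n n_ge2 p_ltn sigma hsigma K cK => [|[|n]] // _ _ sigma hs K _.
have A0 := capacity_const_gt0 n p p_ge1.
(* The constant is positive and finite, so dividing by it reduces the claim to a lower bound for the
   energy of each admissible f. *)
rewrite -lee_pdivrMl //; apply/ereal_infP => _ [f Kf <-].
rewrite lee_pdivrMl //.
apply: le_trans (affine_energy_le sigma hs f p tau p_ge1 tau_geN1 tau_le1 _).
  by apply: ereal_inf_lbound; exists f.
by case: Kf => -[].
Qed.
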